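(* Let $2\mathbb{D}=\{z\in\mathbb{C}:|z|\le 2\}$. The spectral measure $\nu_{\rho_1}$ (over $2\mathbb{D}$) for the graph $\mathcal{H}^{\mathbb{Z}_2^{(3)}}_{\rho_1}$ for $U(2)$ is given by $$\mathrm{d}\nu_{\rho_1}(x)=\frac{1}{\pi^2\sqrt{4-|x|^2}}\,\mathrm{d}x,\qquad x\in 2\mathbb{D},$$ where $\mathrm{d}x$ means $\mathrm{d}r\,\mathrm{d}\theta$ for $x=re^{i\theta}$, $0\le r\le2$, $0\le\theta<2\pi$; whilst the spectral measure $\nu_{\rho_2}$ (over $\mathbb{T}$) for the graph $\mathcal{H}^{\mathbb{Z}_2^{(3)}}_{\rho_2}$ for $U(2)$ is given by $\mathrm{d}\nu_{\rho_2}(y)=(2\pi)^{-1}\,\mathrm{d}y$, $y\in\mathbb{T}$, where $\mathrm{d}y$ is arc length on the unit circle.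
   Context: Here $\rho_1=(1,0)$, $\rho_2=(1,1)$, with characters $\chi_{\rho_1}(\omega_1,\omega_2)=\omega_1+\omega_2$ and $\chi_{\rho_2}(\omega_1,\omega_2)=\omega_1\omega_2$ on $\mathbb{T}^2$ (the restrictions to the maximal torus of the standard representation and the determinant of $U(2)$, whose Weyl group is $\mathbb{Z}_2^{(3)}=\langle\begin{pmatrix}0&1\\1&0\end{pmatrix}\rangle$). With $\sigma_\mu(\omega_1,\omega_2)=\omega_1^{\mu_1}\omega_2^{\mu_2}$, $\mu\in\mathbb{Z}^2$, the graph $\mathcal{H}^{\mathbb{Z}_2^{(3)}}_{\rho}$ has vertex set $\mathbb{Z}^2$ and $n^\rho_{\mu\nu}$ directed edges from $\mu$ to $\nu$, where $\chi_\rho\sigma_\mu=\sum_\nu n^\rho_{\mu\nu}\sigma_\nu$. Thus $\mathcal{H}_{\rho_1}$ has edges $\mu\to\mu+(1,0)$ and $\mu\to\mu+(0,1)$, and $\mathcal{H}_{\rho_2}$ has edges $\mu\to\mu+(1,1)$. The adjacency operator $A_\rho$ is a normal operator on $\ell^2(\mathbb{Z}^2)$, with spectrum $\chi_\rho(\mathbb{T}^2)$ ($2\mathbb{D}$ for $\rho_1$, $\mathbb{T}$ for $\rho_2$). The spectral measure $\nu_\rho$ of the graph is the unique compactly supported probability measure with $\langle A_\rho^m(A_\rho^* )^n\delta_{(0,0)},\delta_{(0,0)}\rangle=\int z^m\overline{z}^n\,\mathrm{d}\nu_\rho(z)$ for all integers $m,n\ge0$. *)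

(* Defs.v *)
From HB Require Import structures.
From mathcomp Require Import all_boot all_order all_algebra.
From mathcomp Require Import all_classical all_reals all_analysis.
From mathcomp Require Import complex.

Set Implicit Arguments.
Unset Strict Implicit.
Unset Printing Implicit Defensive.

Import Order.TTheory GRing.Theory Num.Theory.
Import numFieldNormedType.Exports Normc.

Local Open Scope classical_set_scope.
Local Open Scope complex_scope.
Local Open Scope ring_scope.

Definition Z2 : Type := (int * int)%type.

Section Graph.
Variable R : realType.

Definition torus2 : set (R[i] * R[i]) :=
  [set w | `|w.1| = 1 /\ `|w.2| = 1].

Definition sigma (mu : Z2) (w : R[i] * R[i]) : R[i] := w.1 ^ mu.1 * w.2 ^ mu.2.

Definition chi_rho1 (w : R[i] * R[i]) : R[i] := w.1 + w.2.
Definition chi_rho2 (w : R[i] * R[i]) : R[i] := w.1 * w.2.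

(* The finiteness clause is needed because a sum over an infinite support is 0
   by convention. *)
Definition is_edge_multiplicity (chi : R[i] * R[i] -> R[i])
    (n : Z2 -> Z2 -> nat) : Prop :=
  forall mu : Z2,
    finite_set [set nu | n mu nu != 0%N] /\
    forall w, torus2 w ->
      chi w * sigma mu w = \sum_(nu \in [set: Z2]) (n mu nu)%:R * sigma nu w.

(* Number of edges from mu to nu. For the two characters above multiplicities
   exist, and they are unique since the sigma_mu are linearly independent, so
   the default value of xget plays no role. *)
Definition graphH (chi : R[i] * R[i] -> R[i]) : Z2 -> Z2 -> nat :=
  xget (fun _ _ => 0%N) [set n | is_edge_multiplicity chi n].

End Graph.

Section Operators.
Variable R : realType.

Implicit Types (f g : Z2 -> R[i]) (A B : (Z2 -> R[i]) -> (Z2 -> R[i])).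

Definition l2 f : Prop :=
  (\esum_(x in [set: Z2]) (normc (f x) ^+ 2)%:E < +oo)%E.

(* Sum of an absolutely summable real family. *)
Definition rsum (u : Z2 -> R) : R :=
  fine (\esum_(x in [set: Z2]) (EFin \o u)^\+ x)%E -
  fine (\esum_(x in [set: Z2]) (EFin \o u)^\- x)%E.

Definition inner f g : R[i] :=
  rsum (fun x => complex.Re (f x * (g x)^*)) +i*
  rsum (fun x => complex.Im (f x * (g x)^*)).

Definition delta0 : Z2 -> R[i] := fun x => (x == (0, 0))%:R.

(* The operator sending delta_mu to \sum_nu n_{mu nu} delta_nu. *)
Definition adjacency (n : Z2 -> Z2 -> nat) f : Z2 -> R[i] :=
  fun nu => \sum_(mu \in [set: Z2]) (n mu nu)%:R * f mu.

(* A and B are everywhere-defined operators on l2 (hence bounded, by the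
   Hellinger-Toeplitz theorem) and B is the adjoint of A. *)
Definition is_adjoint A B : Prop :=
  [/\ forall f, l2 f -> l2 (A f),
      forall f, l2 f -> l2 (B f) &
      forall f g, l2 f -> l2 g -> inner (A f) g = inner f (B g)].

End Operators.

(* The complex plane as the product R x R: R[i] carries no measurable
   structure in the libraries, whereas the product carries the Borel
   sigma-algebra and the usual topology. *)
Notation plane R := (measurableTypeR R * measurableTypeR R)%type.

Section SpectralMeasure.
Variable R : realType.

Definition toC (p : plane R) : R[i] := p.1 +i* p.2.

Definition compactly_supported (nu : probability (plane R) R) : Prop :=
  exists K : set (R * R), compact K /\ nu (~` K) = 0%E.

Definition cintegral (nu : probability (plane R) R) (h : plane R -> R[i])
    : R[i] :=
  (\int[nu]_(p in setT) complex.Re (h p)) +i*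
  (\int[nu]_(p in setT) complex.Im (h p)).

Definition has_spectral_moments (A : (Z2 -> R[i]) -> (Z2 -> R[i]))
    (nu : probability (plane R) R) : Prop :=
  compactly_supported nu /\
  exists2 B, is_adjoint A B &
    forall m n : nat,
      inner (iter m A (iter n B (@delta0 R))) (@delta0 R) =
      cintegral nu (fun p => toC p ^+ m * (toC p)^* ^+ n).

Definition is_spectral_measure (A : (Z2 -> R[i]) -> (Z2 -> R[i]))
    (nu : probability (plane R) R) : Prop :=
  has_spectral_moments A nu /\
  forall nu' : probability (plane R) R, has_spectral_moments A nu' ->
    forall E : set (plane R), measurable E -> nu' E = nu E.

End SpectralMeasure.

Section PlaneMeasures.
Variable R : realType.

Definition disk2 : set (plane R) := [set p | normc (toC p) <= 2].

Definition circle1 : set (plane R) := [set p | normc (toC p) = 1].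

Definition polar (q : plane R) : plane R :=
  (q.1 * cos q.2, q.1 * sin q.2).

(* The measure dr dtheta (without the Jacobian r), for x = r e^{i theta}. *)
Definition dr_dtheta : set (plane R) -> \bar R :=
  pushforward
    (fun F : set (plane R) => ((@lebesgue_measure R \x @lebesgue_measure R)%E
      (F `&` ([set` `[0, +oo[%R] `*` [set` `[0, 2 * pi[%R]))))
    polar.

Definition arc_length : set (plane R) -> \bar R :=
  pushforward
    (fun F : set (measurableTypeR R) =>
      @lebesgue_measure R (F `&` [set` `[0, 2 * pi[%R]))
    (fun theta => polar (1, theta)).

End PlaneMeasures.

(* Main.v *)
(** The characters [sigma mu] of the torus are linearly independent (Dedekind), so
    the edge multiplicities are the obvious ones and each adjacency operator is a
    finite sum of translations of Z^2, whose adjoint is the sum of the opposite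
    translations. Counting paths, the moment of order (m, n) is 0 for m <> n, and
    for m = n it is the sum of the C(m, k)^2, i.e. C(2m, m), for rho_1 and 1 for
    rho_2. In polar coordinates the angular integral of z^m conj(z)^n vanishes
    for m <> n, and the radial integral of r^(2m) / sqrt(4 - r^2) over [0, 2[ is
    pi/2 C(2m, m), by induction on m.

    Uniqueness: two compactly supported probabilities with the same moments
    integrate every real polynomial in (x, y) identically; uniformly bounded
    polynomials converging pointwise to the indicator of a quadrant show that they
    agree on quadrants, hence on all Borel sets. *)

Require Import Defs.
From HB Require Import structures.
From mathcomp Require Import all_boot all_order all_algebra.
From mathcomp Require Import all_classical all_reals all_analysis.
From mathcomp Require Import finmap complex measurable_realfun.
From mathcomp Require Import ring lra zify.

Set Implicit Arguments.
Unset Strict Implicit.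
Unset Printing Implicit Defensive.

Import Order.TTheory GRing.Theory Num.Theory.
Import numFieldNormedType.Exports Normc.

Local Open Scope classical_set_scope.
Local Open Scope ring_scope.

(** * Edge multiplicities *)

Section Characters.
Variable R : realType.
Implicit Types (mu nu : Z2) (w : R[i] * R[i]).

(** The competitors in the definition of a spectral measure come with an adjoint [B] of their own,
    constrained only on square-summable functions, so adjoints must first be shown to agree there.
    The densities are taken against bare set functions; the probabilities are therefore built from
    genuine measures convertible to these, and every integral is pulled back to the coordinates (r,
    theta), where it splits into a product. Without the Jacobian r, the first density has total mass
    (pi/2)(2 pi) before normalization, whence the constant pi^2; as it blows up at r = 2, its radial
    integral is improper. For uniqueness, polynomials are never expanded into monomials: the
    functions by which one may multiply without spoiling the equality of moments form an algebra
    containing the coordinates. Pointwise convergence of explicit polynomials with values in [0, 1]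
    is enough, because dominated convergence then replaces uniform approximation. *)

Lemma sigmaM mu (w z : R[i] * R[i]) :
  sigma mu (w.1 * z.1, w.2 * z.2) = sigma mu w * sigma mu z.
Proof. by rewrite /sigma /= !expfzMl mulrACA. Qed.

Lemma torus2M (w z : R[i] * R[i]) :
  torus2 w -> torus2 z -> torus2 (w.1 * z.1, w.2 * z.2).
Proof.
by move=> [w1 w2] [z1 z2]; split => /=; rewrite normrM ?w1 ?w2 ?z1 ?z2 mulr1.
Qed.

Lemma exists_unit_circle_exprN1 (k : nat) :
  exists2 z : R[i], `|z| = 1 & z ^+ k.+1 = -1.
Proof.
have zE : (k.+1.-root (-1 : R[i])) ^+ k.+1 = -1 by rewrite rootCK.
exists (k.+1.-root (-1)) => //.
by apply/eqP; rewrite -(@pexpr_eq1 _ _ k.+1)// -normrX zE normrN1.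
Qed.

(** With [b = a + k.+1], a [k.+1]-th root [z] of -1 gives [z ^ b = - z ^ a], which differs from the
    nonzero [z ^ a]. *)
Lemma exists_unit_circle_exprz_neq (a b : int) : a != b ->
  exists2 z : R[i], `|z| = 1 & z ^ a != z ^ b.
Proof.
wlog ab : a b / a < b => [hw neq|_].
  move: (neq); rewrite neq_lt => /orP[|ba]; first by move/hw; exact.
  by have [|z z1 zab] := hw b a ba; [rewrite eq_sym|exists z => //; rewrite eq_sym].
have [k kE] : exists k : nat, b = a + k.+1%:Z.
  by exists `|b - a|.-1%N; lia.
have [z z1 zk] := exists_unit_circle_exprN1 k.
have z0 : z != 0 by rewrite -normr_gt0 z1.
exists z => //; rewrite kE expfzDr// -exprnP zk mulrN1.
by rewrite -addr_eq0 -mulr2n mulrn_eq0/= expfz_neq0.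
Qed.

Lemma sigma_sep {mu nu} : mu != nu ->
  exists2 w, torus2 w & sigma mu w != sigma nu w :> R[i].
Proof.
case: mu nu => [a b] [c d]; rewrite xpair_eqE negb_and.
case/orP => /exists_unit_circle_exprz_neq[z z1 zE].
  by exists (z, 1); rewrite /torus2/sigma/= ?normr1 ?exp1rz ?mulr1.
by exists (1, z); rewrite /torus2/sigma/= ?normr1 ?exp1rz ?mul1r.
Qed.

(* Dedekind: translating the relation by [z] and subtracting [sigma mu z] times
   the relation kills the term of index [mu]. *)
Lemma sigma_independent (s : seq Z2) (c : Z2 -> R[i]) : uniq s ->
  (forall w, torus2 w -> \sum_(nu <- s) c nu * sigma nu w = 0) ->
  forall nu, nu \in s -> c nu = 0.
Proof.
elim: s c => // mu s IH c /= /andP[mus us] sum0.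
have c0 nu : nu \in s -> c nu = 0.
  move=> nus.
  have [|z tz zE] := @sigma_sep mu nu.
    by apply: contraNneq mus => ->.
  pose c' nu := c nu * (sigma nu z - sigma mu z).
  suff /(IH c' us)/(_ nu nus)/eqP : forall w, torus2 w ->
      \sum_(nu <- s) c' nu * sigma nu w = 0.
    by rewrite mulf_eq0 subr_eq0 [_ == sigma mu z]eq_sym (negbTE zE) orbF => /eqP.
  move=> w tw.
  have := sum0 _ (torus2M tw tz); have := sum0 _ tw.
  rewrite !big_cons sigmaM => /eqP; rewrite addr_eq0 => /eqP muw.
  rewrite mulrA muw mulNr mulr_suml -sumrN -big_split/= => sumE; rewrite -[RHS]sumE.
  by apply: eq_bigr => i _; rewrite sigmaM /c'; ring.
move=> nu; rewrite inE => /predU1P[->|/c0//].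
have := sum0 (1, 1); rewrite /torus2/= normr1 big_cons big1_seq => [|i /andP[_ /c0->]].
  by rewrite addr0 /sigma/= !exp1rz !mulr1; exact.
by rewrite mul0r.
Qed.

Lemma fsbig_sigma (n : Z2 -> nat) (F : {fset Z2}) w :
  (forall nu, nu \notin F -> n nu = 0%N) ->
  \sum_(nu \in [set: Z2]) (n nu)%:R * sigma nu w =
  \sum_(nu <- F) (n nu)%:R * sigma nu w :> R[i].
Proof. by move=> nF; apply: fsbigTE => nu /nF->; rewrite mul0r. Qed.

(** Identifies the [xget] choice with an explicit multiplicity: on the union of the two finite
    supports the differences are the coefficients of a vanishing combination of characters, and
    characteristic 0 brings the equality back to natural numbers. *)
Lemma graphHE (chi : R[i] * R[i] -> R[i]) (n : Z2 -> Z2 -> nat) :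
  is_edge_multiplicity chi n -> graphH chi = n.
Proof.
move=> nP; have : is_edge_multiplicity chi (graphH chi).
  exact: (@xgetPex _ (fun _ _ => 0%N) [set n | is_edge_multiplicity chi n]
           (ex_intro _ n nP)).
move: (graphH chi) => m mP; apply/funext => mu.
have [fm mE] := mP mu; have [fn nE] := nP mu.
pose F := fset_set ([set nu | m mu nu != 0%N] `|` [set nu | n mu nu != 0%N]).
have FP nu : nu \notin F -> m mu nu = 0%N /\ n mu nu = 0%N.
  rewrite /F in_fset_set ?finite_setU// notin_setE/= => /not_orP[].
  by move=> /negP/negPn/eqP-> /negP/negPn/eqP->.
have eqF nu : nu \in F -> (m mu nu)%:R - (n mu nu)%:R = 0 :> R[i].
  move: nu; apply: (@sigma_independent F (fun nu => (m mu nu)%:R - (n mu nu)%:R)).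
    exact: fset_uniq.
  move=> w tw; under eq_bigr do rewrite mulrBl.
  rewrite sumrB -!fsbig_sigma ?mE ?nE// -?mE -?nE ?subrr// => nu /FP[]//.
apply/funext => nu; have [/eqF/eqP|/FP[-> ->]//] := boolP (nu \in F).
by rewrite subr_eq0 eqr_nat => /eqP.
Qed.

Definition edges1 (mu nu : Z2) : nat := (nu == mu + (1, 0)) + (nu == mu + (0, 1)).
Definition edges2 (mu nu : Z2) : nat := nu == mu + (1, 1).

Lemma torus2_neq0 w : torus2 w -> w.1 != 0 /\ w.2 != 0.
Proof. by move=> [w1 w2]; rewrite -!normr_gt0 w1 w2. Qed.

Lemma sigmaD mu nu w : torus2 w -> sigma (mu + nu) w = sigma mu w * sigma nu w.
Proof.
move=> /torus2_neq0[w1 w2]; rewrite /sigma.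
by rewrite -[(mu + nu).1]/(mu.1 + nu.1) -[(mu + nu).2]/(mu.2 + nu.2) !expfzDr// mulrACA.
Qed.

Lemma graphH_rho1 : graphH (@chi_rho1 R) = edges1.
Proof.
apply: graphHE => mu; split.
  apply: (@sub_finite_set _ _ [set mu + (1, 0); mu + (0, 1)]); last exact: finite_set2.
  move=> nu/=; rewrite /edges1; have [->|_] := eqVneq nu (mu + (1, 0)); first by left.
  by have [->|_] := eqVneq nu (mu + (0, 1)); first by right.
move=> w tw; rewrite (@fsbig_sigma _ [fset (mu + (1, 0))%R; (mu + (0, 1))%R]%fset); last first.
  by move=> nu; rewrite !inE /edges1 => /norP[/negbTE-> /negbTE->].
rewrite big_fsetU1/= ?inE; last by rewrite (inj_eq (addrI _)).
rewrite big_seq_fset1 /edges1 !eqxx !(inj_eq (addrI _))/= !mul1r !sigmaD//.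
by rewrite /sigma/= !expr1z !expr0z mulr1 mul1r -mulrDr mulrC.
Qed.

Lemma graphH_rho2 : graphH (@chi_rho2 R) = edges2.
Proof.
apply: graphHE => mu; split.
  apply: (@sub_finite_set _ _ [set mu + (1, 1)]); last exact: finite_set1.
  by move=> nu/=; rewrite /edges2; have [->|] := eqVneq nu (mu + (1, 1)).
move=> w tw; rewrite (@fsbig_sigma _ [fset (mu + (1, 1))%R]%fset); last first.
  by move=> nu; rewrite !inE /edges2 => /negbTE->.
by rewrite big_seq_fset1 /edges2 eqxx mul1r sigmaD// /sigma/= !expr1z mulrC.
Qed.

End Characters.
(** * Translations on the square-summable functions *)

Section SquareSummable.
Variable R : realType.
Implicit Types (u v : Z2 -> R) (f g h : Z2 -> R[i]).
Local Open Scope complex_scope.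

Lemma ReD (x y : R[i]) : complex.Re (x + y) = complex.Re x + complex.Re y.
Proof. by case: x y => [a b] [c d]. Qed.

Lemma ImD (x y : R[i]) : complex.Im (x + y) = complex.Im x + complex.Im y.
Proof. by case: x y => [a b] [c d]. Qed.

Lemma normc_sqr (x : R[i]) : normc x ^+ 2 = complex.Re x ^+ 2 + complex.Im x ^+ 2.
Proof. by case: x => a b /=; rewrite sqr_sqrtr// addr_ge0 ?sqr_ge0. Qed.

Lemma esum_point (T : choiceType) (a : T -> \bar R) (y : T) :
  (forall x, 0 <= a x)%E -> (forall x, x != y -> a x = 0%E) ->
  (\esum_(x in [set: T]) a x = a y)%E.
Proof.
move=> a0 ay; rewrite (esumID [set y])//.
rewrite (_ : _ `&` [set y] = [set y]) ?setTI// esum_set1//.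
by rewrite [X in (_ + X)%E]esum1 ?adde0// => x /eqP; exact: ay.
Qed.

Lemma rsum_point u y : (forall x, x != y -> u x = 0) -> rsum u = u y.
Proof.
move=> uy; rewrite /rsum !(@esum_point _ _ y)//; last 2 first.
  by move=> x /uy ux; rewrite funenegE /= ux ?oppr0 ?oppe0 maxxx.
  by move=> x /uy ux; rewrite funeposE /= ux maxxx.
rewrite funeposE funenegE /= -!EFin_max /= /Num.max.
by case: ltP => ?; case: ltP => ?; lra.
Qed.

(** Frees [rsum] from the canonical positive and negative parts. Additivity rests on this, since the
    positive part of a sum is not the sum of the positive parts. *)
Lemma rsumB_ge0 (p q : Z2 -> R) :
  (forall x, 0 <= p x) -> (forall x, 0 <= q x) ->
  summable setT (EFin \o p) -> summable setT (EFin \o q) ->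
  rsum (fun x => p x - q x) =
  fine (\esum_(x in setT) (p x)%:E) - fine (\esum_(x in setT) (q x)%:E).
Proof.
move=> p0 q0 sp sq.
have spq : summable setT (EFin \o (fun x => p x - q x)).
  apply: le_lt_trans (summableB sp sq); exact: le_esum.
have fp (a : Z2 -> \bar R) : (forall x, 0 <= a x)%E -> summable setT a ->
    (\esum_(x in setT) a x)%E \is a fin_num.
  move=> a0; rewrite summableE; congr (_ \is a fin_num).
  by apply: eq_esum => x _; rewrite gee0_abs.
rewrite /rsum -!fineB ?fp//; last 2 first.
  by apply: summable_funepos.
  by apply: summable_funeneg.
congr fine; rewrite -(esumB sp sq)//; last 2 first.
  by move=> x _; rewrite lee_fin.
  by move=> x _; rewrite lee_fin.
Qed.

Lemma summable_posneg u : summable setT (EFin \o u) ->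
  summable setT (EFin \o u^\+) /\ summable setT (EFin \o u^\-).
Proof.
move=> su; split; apply: le_lt_trans su; apply: le_esum => x _ /=; rewrite lee_fin.
  rewrite ger0_norm ?funrpos_ge0// /funrpos /Num.max; case: ltP => //.
  by rewrite ler_norm.
rewrite ger0_norm ?funrneg_ge0// /funrneg /Num.max; case: ltP => //.
by rewrite -normrN ler_norm.
Qed.

Lemma rsumD u v : summable setT (EFin \o u) -> summable setT (EFin \o v) ->
  rsum (fun x => u x + v x) = rsum u + rsum v.
Proof.
move=> su sv.
have [up un] := summable_posneg su; have [vp vn] := summable_posneg sv.
have fp (a : Z2 -> R) : (forall x, 0 <= a x) -> summable setT (EFin \o a) ->
    (\esum_(x in setT) (a x)%:E)%E \is a fin_num.
  move=> a0; rewrite summableE; congr (_ \is a fin_num).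
  by apply: eq_esum => x _ /=; rewrite ger0_norm.
have sD (a b : Z2 -> R) : summable setT (EFin \o a) -> summable setT (EFin \o b) ->
    summable setT (EFin \o (fun x => a x + b x)) by exact: summableD.
have E (w : Z2 -> R) : w = fun x => w^\+ x - w^\- x.
  exact/esym/funrposBneg.
transitivity (rsum (fun x => (u^\+ x + v^\+ x) - (u^\- x + v^\- x))).
  congr rsum; apply/funext => x.
  by rewrite [in LHS](E u) [in LHS](E v) opprD addrACA.
rewrite rsumB_ge0; [|by move=> x; rewrite addr_ge0 ?funrpos_ge0 ?funrneg_ge0..
  |exact: sD|exact: sD].
rewrite [in RHS](E u) [in RHS](E v).
rewrite !rsumB_ge0//; try by move=> x; rewrite ?funrpos_ge0 ?funrneg_ge0.
under eq_esum do rewrite EFinD.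
under [in X in _ - fine X]eq_esum do rewrite EFinD.
rewrite !esumD//; try by move=> x _; rewrite lee_fin ?funrpos_ge0 ?funrneg_ge0.
rewrite !fineD ?fp//; try by move=> x; rewrite ?funrpos_ge0 ?funrneg_ge0.
by rewrite opprD addrACA.
Qed.

Lemma esum_shift (a : Z2 -> \bar R) (e : Z2) :
  (\esum_(x in [set: Z2]) a x = \esum_(x in [set: Z2]) a ((x : Z2) + e)%R)%E.
Proof.
apply: reindex_esum; split => //.
  by move=> x y _ _; exact: addIr.
by move=> y _; exists (y - e) => //; rewrite subrK.
Qed.

Lemma rsum_shift u (e : Z2) : rsum u = rsum (fun x => u (x + e)).
Proof. rewrite /rsum (esum_shift _ e) [in X in _ - X = _](esum_shift _ e).
by congr (fine _ - fine _); apply: eq_esum => x _; rewrite ?funeposE ?funenegE. Qed.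

Lemma l2_0 : l2 (0 : Z2 -> R[i]).
Proof.
rewrite /l2 esum1 => [|x _]; first exact: ltry.
by rewrite normc_sqr /= expr0n addr0.
Qed.

Lemma l2D f g : l2 f -> l2 g -> l2 (fun x => f x + g x).
Proof.
move=> lf lg.
(* Each sum is taken twice because |a + b|^2 <= 2|a|^2 + 2|b|^2. *)
have := lte_add_pinfty (lte_add_pinfty lf lf) (lte_add_pinfty lg lg).
rewrite -!esumD//; try by move=> *; rewrite ?adde_ge0// lee_fin sqr_ge0.
apply: le_lt_trans; apply: le_esum => x _; rewrite -!EFinD lee_fin.
rewrite !normc_sqr ReD ImD; set a := complex.Re _; set b := complex.Re _.
set c := complex.Im _; set d := complex.Im _.
have := sqr_ge0 (a - b); have := sqr_ge0 (c - d); nra.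
Qed.

Lemma l2_shift f (e : Z2) : l2 f -> l2 (fun x => f (x + e)).
Proof. by rewrite /l2 (esum_shift _ e). Qed.

(** Both parts of [f x * (g x)^*] are bounded in absolute value by |f x|^2 + |g x|^2. *)
Lemma summable_inner f g : l2 f -> l2 g ->
  summable setT (EFin \o (fun x => complex.Re (f x * (g x)^*))) /\
  summable setT (EFin \o (fun x => complex.Im (f x * (g x)^*))).
Proof.
move=> lf lg; have := lte_add_pinfty lf lg.
rewrite -esumD//; try by move=> *; rewrite lee_fin sqr_ge0.
move=> fg; split; apply: le_lt_trans fg; apply: le_esum => x _;
  rewrite /= lee_fin !normc_sqr; case: (f x) (g x) => [a b] [c d] /=;
  rewrite ler_norml; apply/andP.
  split; have := sqr_ge0 (a - c); have := sqr_ge0 (b - d);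
  have := sqr_ge0 (a + c); have := sqr_ge0 (b + d); nra.
split; have := sqr_ge0 (a - d); have := sqr_ge0 (b - c);
  have := sqr_ge0 (a + d); have := sqr_ge0 (b + c); nra.
Qed.

Lemma innerDl f g h : l2 f -> l2 g -> l2 h ->
  inner (fun x => f x + g x) h = inner f h + inner g h.
Proof.
move=> lf lg lh.
have [fr fi] := summable_inner lf lh; have [gr gi] := summable_inner lg lh.
rewrite /inner; under eq_fun do rewrite mulrDl ReD.
under [in X in _ +i* X]eq_fun do rewrite mulrDl ImD.
by rewrite !rsumD.
Qed.

Lemma innerDr f g h : l2 f -> l2 g -> l2 h ->
  inner f (fun x => g x + h x) = inner f g + inner f h.
Proof.
move=> lf lg lh.
have [fr fi] := summable_inner lf lh; have [gr gi] := summable_inner lf lg.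
rewrite /inner; under eq_fun do rewrite rmorphD mulrDr ReD.
under [in X in _ +i* X]eq_fun do rewrite rmorphD mulrDr ImD.
by rewrite !rsumD.
Qed.

Lemma inner_shift f g (e : Z2) :
  inner (fun x => f (x - e)) g = inner f (fun x => g (x + e)).
Proof.
rewrite /inner (rsum_shift _ e); under eq_fun do rewrite addrK.
congr (_ +i* _); rewrite (rsum_shift _ e).
by under eq_fun do rewrite addrK.
Qed.

(** Needed at every vertex, because testing against all of them pins down an adjoint; [delta0] is
    the case [(0, 0)] by conversion. *)
Definition delta (y : Z2) : Z2 -> R[i] := fun x => (x == y)%:R.

Lemma delta_neq (x y : Z2) : x != y -> delta y x = 0.
Proof. by rewrite /delta => /negbTE->. Qed.

Lemma inner_deltar f y : inner f (delta y) = f y.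
Proof.
rewrite /inner !(@rsum_point _ y); last 2 first.
  by move=> x /delta_neq->; rewrite rmorph0 mulr0.
  by move=> x /delta_neq->; rewrite rmorph0 mulr0.
by rewrite /delta eqxx rmorph1 mulr1; case: (f y).
Qed.

Lemma inner_deltal f y : inner (delta y) f = (f y)^*.
Proof.
rewrite /inner !(@rsum_point _ y); last 2 first.
  by move=> x /delta_neq->; rewrite mul0r.
  by move=> x /delta_neq->; rewrite mul0r.
by rewrite /delta eqxx mul1r; case: (f y).
Qed.

Lemma l2_delta y : l2 (delta y).
Proof.
rewrite /l2 (@esum_point _ _ y); first exact: ltry.
  by move=> x; rewrite lee_fin sqr_ge0.
by move=> x /delta_neq->; rewrite normc_sqr/= expr0n addr0.
Qed.

(** The conjugate of [B f y] is [inner (delta y) (B f) = inner (A (delta y)) f], which does not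
    involve [B]. *)
Lemma adjoint_unique (A B B' : (Z2 -> R[i]) -> (Z2 -> R[i])) :
  is_adjoint A B -> is_adjoint A B' -> forall f, l2 f -> B f = B' f.
Proof.
move=> [lA lB AB] [_ lB' AB'] f lf; apply/funext => y.
apply: (can_inj (@conjcK R)); rewrite -!inner_deltal.
by rewrite -AB -?AB'//; exact: l2_delta.
Qed.

Lemma l2_iter (B : (Z2 -> R[i]) -> (Z2 -> R[i])) n f :
  (forall g, l2 g -> l2 (B g)) -> l2 f -> l2 (iter n B f).
Proof. by move=> lB lf; elim: n => //= n; exact: lB. Qed.

(** Two adjoints agree only on [l2], so the iterates have to stay there. *)
Lemma adjoint_iter (A B B' : (Z2 -> R[i]) -> (Z2 -> R[i])) n f :
  is_adjoint A B -> is_adjoint A B' -> l2 f -> iter n B f = iter n B' f.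
Proof.
move=> AB AB' lf; elim: n => //= n <-.
by apply: (adjoint_unique AB AB'); apply: l2_iter => //; case: AB.
Qed.

(** Convolution with the sum of the point masses at the entries of [s]. With a list as index, the
    adjoint is given by [map -%R s] and the proofs are inductions. *)
Fixpoint translations (s : seq Z2) f : Z2 -> R[i] :=
  if s is e :: s' then fun x => f (x - e) + translations s' f x else 0.

Lemma l2_translations s f : l2 f -> l2 (translations s f).
Proof.
move=> lf; elim: s => [|e s IH]; first exact: l2_0.
by apply: l2D => //; apply: l2_shift.
Qed.

Lemma is_adjoint_translations s :
  is_adjoint (translations s) (translations (map -%R s)).
Proof.
split => [f|f|f g lf lg]; [exact: l2_translations..|].
elim: s => [|e s IH] /=.
  rewrite /inner.
  by rewrite !(@rsum_point _ 0) ?mul0r ?rmorph0 ?mulr0// => *; rewrite ?mul0r ?rmorph0 ?mulr0.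
rewrite innerDl//; [|exact: l2_shift|exact: l2_translations].
rewrite innerDr//; [|by apply: l2_shift|exact: l2_translations].
by rewrite IH inner_shift opprK.
Qed.

End SquareSummable.

(** * Moments of the adjacency operators by counting lattice paths *)

Section LatticePaths.
Variable R : realType.
Implicit Types (f : Z2 -> R[i]).
Local Open Scope complex_scope.

Lemma adjacency_edges1 : @adjacency R edges1 = translations [:: (1, 0); (0, 1)].
Proof.
apply/funext => f; apply/funext => nu; rewrite /adjacency.
(* Mass moves along the edges, so the value at [nu] is read at its two predecessors. *)
rewrite (@fsbigTE _ _ _ _ [fset (nu - (1, 0))%R; (nu - (0, 1))%R]%fset); last first.
  move=> mu; rewrite !inE /edges1 => /norP[/negbTE n1 /negbTE n2].
  by rewrite -!subr_eq ![nu - _ == mu]eq_sym n1 n2 mul0r.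
rewrite big_fsetU1/= ?inE; last by rewrite (inj_eq (addrI _)).
rewrite big_seq_fset1 /edges1 !subrK !eqxx /= addr0.
rewrite -[in X in X + _]subr_eq -[in X in _ + X]subr_eq.
by rewrite !(inj_eq (addrI _))/= !mul1r.
Qed.

Lemma adjacency_edges2 : @adjacency R edges2 = translations [:: (1, 1)].
Proof.
apply/funext => f; apply/funext => nu; rewrite /adjacency.
rewrite (@fsbigTE _ _ _ _ [fset (nu - (1, 1))%R]%fset); last first.
  move=> mu; rewrite !inE /edges2 => /negbTE n1.
  by rewrite -subr_eq [nu - _ == mu]eq_sym n1 mul0r.
by rewrite big_seq_fset1 /edges2 !subrK eqxx mul1r /= addr0.
Qed.

Lemma pascal_sum (m : nat) (g : nat -> R[i]) :
  \sum_(k < m.+2) 'C(m.+1, k)%:R * g k =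
  \sum_(k < m.+1) 'C(m, k)%:R * g k.+1 + \sum_(k < m.+1) 'C(m, k)%:R * g k.
Proof.
rewrite big_ord_recl bin0 mul1r; under eq_bigr do rewrite lift0 binS natrD mulrDl.
rewrite big_split/= addrA addrC; congr (_ + _).
rewrite [in RHS]big_ord_recl bin0 mul1r big_ord_recr/= bin_small// mul0r addr0.
by congr (_ + _).
Qed.

(** Binomial theorem for two commuting translations: [k] counts the steps along [a]. *)
Lemma iter_translations2 (a b : Z2) m f x :
  iter m (translations [:: a; b]) f x =
  \sum_(k < m.+1) 'C(m, k)%:R * f (x - (a *+ k + b *+ (m - k))).
Proof.
elim: m x => [|m IH] x; first by rewrite big_ord1 bin0 mul1r subnn !mulr0n addr0.
rewrite (@pascal_sum m (fun k => f (x - (a *+ k + b *+ (m.+1 - k))))).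
rewrite iterS [LHS]/= addr0 !IH; congr (_ + _); apply: eq_bigr => k _; congr (_ * f _).
  by rewrite mulrS subSS opprD addrA !opprD !addrA.
rewrite subSn; last by rewrite -ltnS.
by rewrite mulrS -addrA -opprD addrCA.
Qed.

Lemma iter_translations1 (a : Z2) m f x :
  iter m (translations [:: a]) f x = f (x - a *+ m).
Proof.
elim: m x => [|m IH] x; first by rewrite mulr0n subr0.
by rewrite iterS [LHS]/= addr0 IH mulrS opprD addrA.
Qed.

Lemma mulrn_pair (a b : int) k : (a, b) *+ k = (a *+ k, b *+ k) :> Z2.
Proof. by elim: k => // k IH; rewrite !mulrS IH. Qed.

Lemma moments_edges1 m n :
  inner (iter m (translations [:: (1, 0); (0, 1)])
          (iter n (translations (map -%R [:: (1, 0); (0, 1)])) (@delta0 R))) (@delta0 R)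
  = if m == n then 'C(m.*2, m)%:R else 0.
Proof.
rewrite inner_deltar iter_translations2.
(* A path with [k] and [m - k] steps in the two directions, followed by a backward path with [j] and
   [n - j] steps, closes up exactly when [k = j] and [m - k = n - j]. *)
have deltaE (k j : nat) : (k <= m)%N -> (j <= n)%N ->
    @delta0 R ((0, 0) - ((1, 0) *+ k + (0, 1) *+ (m - k)) -
            (- (1, 0) *+ j + - (0, 1) *+ (n - j)))
    = ((m == n) && (k == j))%:R.
  move=> km jn; rewrite /delta0 !mulNrn !mulrn_pair !mul0rn !natz.
  rewrite -[_ - _ - _]/(_, _) xpair_eqE/=; congr ((nat_of_bool _)%:R).
  apply/andP/andP => -[/eqP ? /eqP ?]; split; apply/eqP; lia.
under eq_bigr => k _ do rewrite iter_translations2.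
have [emn|mn] := eqVneq m n; last first.
  rewrite big1// => k _; rewrite big1 ?mulr0// => j _.
  by rewrite [delta0 _ _](deltaE k j) ?(negbTE mn) ?mulr0// -ltnS.
subst n; transitivity (\sum_(k < m.+1) 'C(m, k)%:R * 'C(m, k)%:R : R[i]).
  apply: eq_bigr => k _; congr (_ * _); rewrite (bigD1 k)//= [delta0 _ _](deltaE k k) -1?ltnS//.
  rewrite !eqxx mulr1 big1 ?addr0// => j jk.
  by rewrite [delta0 _ _](deltaE k j) -1?ltnS// eqxx/= eq_sym (inj_eq val_inj) (negbTE jk) mulr0.
(* Vandermonde's convolution, one factor of each square being read as ['C(m, m - k)]. *)
rewrite -addnn -binomial.Vandermonde natr_sum; apply: eq_bigr => k _.
by rewrite natrM; congr (_ * _); rewrite bin_sub// -ltnS.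
Qed.

Lemma moments_edges2 m n :
  inner (iter m (translations [:: (1, 1)])
          (iter n (translations (map -%R [:: (1, 1)])) (@delta0 R))) (@delta0 R)
  = (m == n)%:R.
Proof.
rewrite inner_deltar !iter_translations1 /delta0 mulNrn !mulrn_pair !natz.
rewrite -[_ - _ - _]/(_, _) xpair_eqE/= andbb; congr ((nat_of_bool _)%:R).
by apply/eqP/eqP; lia.
Qed.

End LatticePaths.
(** * Uniqueness of the moment problem *)

Section StepPolynomials.
Variable R : realType.
Implicit Types (t u : R).

(* On [0, 1], [step k] converges pointwise to the indicator of ]1/2, 1]: with
   c = 2^(k^2 - k), the product c u^(k^2) is at most 2^-k for u <= 1/2, and tends
   to infinity for u > 1/2. *)
Definition step (k : nat) (u : R) : R :=
  1 - (1 - u ^+ (k * k)) ^+ (2 ^ (k * k - k)).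

Lemma bernoulli t n : -1 <= t -> 1 + t *+ n <= (1 + t) ^+ n.
Proof.
move=> t1; elim: n => [|n IH]; first by rewrite mulr0n addr0 expr0.
have t0 : 0 <= 1 + t by lra.
rewrite exprS; apply: le_trans (ler_wpM2l t0 IH).
rewrite mulrS mulrDl !mulrDr !mul1r mulr1 -!addrA lerD2l.
by rewrite addrCA lerD2l lerDl mulrnAr mulrn_wge0// -expr2 sqr_ge0.
Qed.

Lemma step_ge0 k u : 0 <= u <= 1 -> 0 <= step k u.
Proof.
move=> /andP[u0 u1]; rewrite subr_ge0 exprn_ile1// ?subr_ge0 ?exprn_ile1//.
by rewrite lerBlDr lerDl exprn_ge0.
Qed.

Lemma step_le1 k u : 0 <= u <= 1 -> step k u <= 1.
Proof.
by move=> /andP[u0 u1]; rewrite lerBlDr lerDl exprn_ge0// subr_ge0 exprn_ile1.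
Qed.

(** With t = u^(k^2) and c = 2^(k^2 - k), Bernoulli's inequality at -t gives 1 - (1 - t)^c <= c
    t. *)
Lemma step_le_half k u : 0 <= u -> u <= 2^-1 -> step k u <= 2^-1 ^+ k.
Proof.
move=> u0 u1; have ut : u ^+ (k * k) <= 2^-1 ^+ (k * k).
  by apply: lerXn2r => //; rewrite nnegrE.
have t0 : 0 <= u ^+ (k * k) by rewrite exprn_ge0.
have h1 : (2^-1 : R) ^+ (k * k) <= 1 by rewrite exprn_ile1//; lra.
have := @bernoulli (- u ^+ (k * k)) (2 ^ (k * k - k)); rewrite lerNl opprK.
move=> /(_ (le_trans ut h1)); rewrite /step => b.
rewrite lerBlDr -lerBlDl; apply: le_trans b; rewrite lerD2l mulNrn lerN2.
apply: (@le_trans _ _ ((2^-1 ^+ (k * k)) *+ 2 ^ (k * k - k))); first by rewrite lerMn2r ut orbT.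
rewrite -mulr_natr natrX.
have -> : (k * k = k + (k * k - k))%N by rewrite subnKC//; case: (k) => // n; rewrite leq_pmulr.
by rewrite exprD -mulrA addKn -exprMn mulVf// expr1n mulr1.
Qed.

(** Since (1 - t)(1 + t) <= 1, Bernoulli's inequality yields (1 - t)^c <= 1 / (1 + c t). The
    hypothesis makes c t large: 2^k c t = ((2u)^k)^k >= 4^k, so c t >= 2^k. *)
Lemma step_ge_half k u : 0 <= u -> u <= 1 -> 4 <= (2 * u) ^+ k ->
  1 - 2^-1 ^+ k <= step k u.
Proof.
move=> u0 u1 u4; rewrite /step lerD2l lerN2.
set t := u ^+ _; set c := (2 ^ _)%N.
have t0 : 0 <= t by rewrite exprn_ge0.
have t1 : t <= 1 by rewrite exprn_ile1.
have ct : 2 ^+ k <= t *+ c.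
  rewrite -(@ler_pM2l _ (2 ^+ k)) ?exprn_gt0// -exprMn -[t *+ c]mulr_natr /c natrX mulrA.
  have -> : 2 ^+ k * t * 2 ^+ (k * k - k) = ((2 * u) ^+ k) ^+ k.
    rewrite mulrAC -exprD subnKC; last by case: (k) => // n; rewrite leq_pmulr.
    by rewrite -exprM exprMn.
  rewrite (_ : 2 * 2 = 4); last by ring.
  by apply: lerXn2r => //; rewrite nnegrE ?exprn_ge0 ?mulr_ge0.
have c1 : (1 - t) ^+ c * 2 ^+ k <= 1.
  apply: (@le_trans _ _ ((1 - t) ^+ c * (1 + t) ^+ c)).
    rewrite ler_wpM2l ?exprn_ge0 ?subr_ge0//.
    apply: le_trans (bernoulli c _); last by lra.
    by apply: le_trans ct _; rewrite lerDr.
  rewrite -exprMn exprn_ile1//; nra.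
by rewrite exprVn -[leRHS]mul1r ler_pdivlMr ?exprn_gt0.
Qed.

Lemma cvg_half : (2^-1 : R) ^+ k @[k --> \oo] --> (0 : R).
Proof. by apply: cvg_expr; rewrite ger0_norm; lra. Qed.

Lemma cvg_step0 u : 0 <= u -> u <= 2^-1 -> step k u @[k --> \oo] --> (0 : R).
Proof.
move=> u0 u1; apply: (squeeze_cvgr _ (cvg_cst 0) cvg_half).
apply: nearW => k; rewrite step_ge0 ?u0/= ?step_le_half//; lra.
Qed.

Lemma cvg_step1 u : 2^-1 < u -> u <= 1 -> step k u @[k --> \oo] --> (1 : R).
Proof.
move=> u0 u1; have h : (1 - 2^-1 ^+ k : R) @[k --> \oo] --> (1 : R).
  by rewrite -[X in _ --> X]subr0; apply: cvgB; [exact: cvg_cst|exact: cvg_half].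
have d0 : 0 < 2 * u - 1 by lra.
apply: (@squeeze_cvgr _ _ _ _ (fun k : nat => 1 - 2^-1 ^+ k) (fun=> 1)); [|exact: h|exact: cvg_cst].
near=> k; rewrite step_le1 ?andbT; last by rewrite u1 andbT; lra.
apply: step_ge_half => //; first by lra.
(* Chosen so that Bernoulli's inequality gives (2u)^k >= 1 + k(2u - 1) >= 4. *)
have k3 : 3 / (2 * u - 1) <= k%:R by near: k; exact: nbhs_infty_ger.
rewrite ler_pdivrMr// mulr_natl in k3.
rewrite -[2 * u](subrK 1) addrC; apply: le_trans (bernoulli k _); lra.
Unshelve. all: by end_near. Qed.

End StepPolynomials.

(** * Measures determined by their values on rays and quadrants *)

Section PlaneMeasures.
Variable R : realType.

Lemma ray_measure_unique (m1 m2 : {measure set (measurableTypeR R) -> \bar R}) :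
  (m1 setT < +oo)%E ->
  (forall a, m1 `]a, +oo[%classic = m2 `]a, +oo[%classic) ->
  forall A, measurable A -> m1 A = m2 A.
Proof.
move=> m1oo m12 A mA.
apply: (@measure_unique _ R (measurableTypeR R) (@RGenOInfty.G R)
  (fun k => `]- k%:R, +oo[%classic) _ _ _ _ m1 m2) => //.
- exact: RGenOInfty.measurableE.
- move=> _ _ [a ->] [b ->]; exists (Num.max a b).
  by apply/seteqP; split => x /=; rewrite !in_itv/= !andbT gt_max => /andP.
- by move=> k; exists (- k%:R).
- apply/seteqP; split => // x _; exists (Num.truncn `|x|).+1 => //=.
  rewrite in_itv/= andbT ltrNl (le_lt_trans _ (truncnS_gt _))//.
  by rewrite -normrN ler_norm.
- by move=> _ [a ->].
- move=> k; apply: le_lt_trans m1oo; apply: le_measure => //; apply: mem_set.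
    exact: measurable_itv.
  exact: measurableT.
Qed.

(** One coordinate at a time: restricting to a strip and projecting to the other axis reduces to
    rays, first with []b, +oo[] as second factor, then with a fixed measurable first factor.
    Measurable rectangles then generate the product sigma-algebra. *)
Lemma quadrant_measure_unique (m1 m2 : probability (plane R) R) :
  (forall a b, m1 (`]a, +oo[ `*` `]b, +oo[) = m2 (`]a, +oo[ `*` `]b, +oo[)) ->
  forall E, measurable E -> m1 E = m2 E.
Proof.
move=> m12.
have mf : measurable_fun [set: plane R] fst by exact: measurable_fst.
have ms : measurable_fun [set: plane R] snd by exact: measurable_snd.
have fin (m : probability (plane R) R) (E : set (plane R)) : measurable E -> (m E < +oo)%E.
  by move=> mE; rewrite (le_lt_trans (probability_le1 _ _))// ltry.
have step1 b A : measurable A -> m1 (A `*` `]b, +oo[) = m2 (A `*` `]b, +oo[).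
  move=> mA.
  have mB : measurable (snd @^-1` `]b, +oo[%classic : set (plane R)).
    by rewrite -[X in measurable X]setTI; exact: ms.
  apply: (@ray_measure_unique
    (pushforward (mrestr m1 mB) fst) (pushforward (mrestr m2 mB) fst)) mA.
    by apply: (fin m1); rewrite preimage_setT setTI.
  by move=> a; exact: m12.
have step2 A B : measurable A -> measurable B -> m1 (A `*` B) = m2 (A `*` B).
  move=> mA mB.
  have mA' : measurable (fst @^-1` A : set (plane R)).
    by rewrite -[X in measurable X]setTI; exact: mf.
  have XE (C : set R) : A `*` C = snd @^-1` C `&` fst @^-1` A :> set (plane R).
    by apply/seteqP; split => -[x y] [].
  rewrite XE.
  apply: (@ray_measure_unique
    (pushforward (mrestr m1 mA') snd) (pushforward (mrestr m2 mA') snd)) mB.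
    by apply: (fin m1); rewrite preimage_setT setTI.
  by move=> b; have := step1 b A mA; rewrite XE.
move=> E mE.
apply: (measure_unique [set A `*` B | A in measurable & B in measurable] (fun=> setT)) => //.
- exact: measurable_prod_measurableType.
- move=> _ _ [A mA [B mB <-]] [C mC [D mD <-]].
  by exists (A `&` C); [exact: measurableI|exists (B `&` D); [exact: measurableI|rewrite setXI]].
- by move=> _; exists setT => //; exists setT => //; rewrite setXTT.
- by rewrite bigcup_const.
- by move=> _ [A mA [B mB <-]]; exact: step2.
- by move=> _; exact: fin.
Qed.

End PlaneMeasures.

(** * Functions whose integrals are determined by the moments *)

Section MomentProblem.
Variable R : realType.
Variable M : R.
Local Open Scope complex_scope.
Implicit Types (f g : plane R -> R) (h : plane R -> R[i]).

Definition square : set (plane R) := [set p | `|p.1| <= M /\ `|p.2| <= M].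

Lemma measurable_square : measurable square.
Proof.
have -> : square = fst @^-1` `[- M, M]%classic `&` snd @^-1` `[- M, M]%classic.
  by apply/seteqP; split => p; rewrite /square/= !in_itv/= !ler_norml.
apply: measurableI; rewrite -[X in measurable X]setTI.
  by apply: measurable_fst => //; exact: measurable_itv.
by apply: measurable_snd => //; exact: measurable_itv.
Qed.

(** Boundedness is asked on [square] only, as the coordinates are unbounded on the plane. It passes
    to products and gives integrability against a probability carried by [square]. *)
Definition admissible f := measurable_fun setT f /\
  exists C, forall p, square p -> `|f p| <= C.

Lemma admissible_cst c : admissible (fun=> c).
Proof. by split => //; exists `|c|. Qed.

Lemma admissible_fst : admissible fst.
Proof. by split; [exact: measurable_fst|exists M => p []]. Qed.

Lemma admissible_snd : admissible snd.
Proof. by split; [exact: measurable_snd|exists M => p []]. Qed.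

Lemma admissibleD f g : admissible f -> admissible g ->
  admissible (fun p => f p + g p).
Proof.
move=> [mf [C fC]] [mg [D gD]]; split; first exact: measurable_funD.
by exists (C + D) => p Sp; rewrite (le_trans (ler_normD _ _))// lerD ?fC ?gD.
Qed.

Lemma admissibleM f g : admissible f -> admissible g ->
  admissible (fun p => f p * g p).
Proof.
move=> [mf [C fC]] [mg [D gD]]; split; first exact: measurable_funM.
by exists (C * D) => p Sp; rewrite normrM ler_pM ?fC ?gD.
Qed.

Lemma admissibleZ c f : admissible f -> admissible (fun p => c * f p).
Proof. by move=> /(admissibleM (admissible_cst c)). Qed.

Lemma ae_square (nu : probability (plane R) R) : nu (~` square) = 0%E ->
  {ae nu, forall p, square p}.
Proof.
by move=> nu0; exists (~` square); split => //; apply: measurableC; exact: measurable_square.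
Qed.

Lemma integrable_admissible (nu : probability (plane R) R) f :
  nu (~` square) = 0%E -> admissible f -> nu.-integrable setT (EFin \o f).
Proof.
move=> nuS [mf [C fC]]; have mEf : measurable_fun setT (EFin \o f).
  exact/measurable_EFinP.
apply/integrableP; split => //.
(* The absolute value is there because [C] may be negative when [square] is empty. *)
apply: (le_lt_trans (integral_le_bound (`|C|)%:E measurableT mEf _ _)).
- by rewrite lee_fin.
- apply: filterS (ae_square nuS) => p Sp _.
  by rewrite lee_fin (le_trans (fC _ Sp))// ler_norm.
- by apply: lte_mul_pinfty; rewrite ?lee_fin// ltey_eq fin_num_measure.
Qed.

Definition cadmissible h :=
  admissible (fun p => complex.Re (h p)) /\ admissible (fun p => complex.Im (h p)).

Lemma cadmissibleM h1 h2 : cadmissible h1 -> cadmissible h2 ->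
  cadmissible (fun p => h1 p * h2 p).
Proof.
move=> [r1 i1] [r2 i2]; split.
  rewrite (_ : (fun p => _) = fun p =>
    complex.Re (h1 p) * complex.Re (h2 p) + (-1) * (complex.Im (h1 p) * complex.Im (h2 p))).
    by apply: admissibleD; [exact: admissibleM|apply/admissibleZ/admissibleM].
  by apply/funext => p; case: (h1 p) (h2 p) => [a b] [c d] /=; rewrite mulN1r.
rewrite (_ : (fun p => _) = fun p =>
    complex.Re (h1 p) * complex.Im (h2 p) + complex.Im (h1 p) * complex.Re (h2 p)).
  by apply: admissibleD; exact: admissibleM.
by apply/funext => p; case: (h1 p) (h2 p) => [a b] [c d].
Qed.

Lemma cadmissibleX h n : cadmissible h -> cadmissible (fun p => h p ^+ n).
Proof.
move=> ah; elim: n => [|n IH]; first by split; exact: admissible_cst.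
under eq_fun do rewrite exprS; exact: cadmissibleM.
Qed.

Lemma cadmissible_monomial m n :
  cadmissible (fun p : plane R => toC p ^+ m * (toC p)^* ^+ n).
Proof.
apply: cadmissibleM; apply: cadmissibleX.
  by split; [exact: admissible_fst|exact: admissible_snd].
split; first exact: admissible_fst.
by rewrite /=; under eq_fun do rewrite -mulN1r; apply: admissibleZ admissible_snd.
Qed.

Variables nu nu' : probability (plane R) R.
Hypotheses (nuS : nu (~` square) = 0%E) (nu'S : nu' (~` square) = 0%E).
Hypothesis moments : forall m n : nat,
  cintegral nu (fun p => toC p ^+ m * (toC p)^* ^+ n) =
  cintegral nu' (fun p => toC p ^+ m * (toC p)^* ^+ n).

Definition same_integral h := cadmissible h /\ cintegral nu h = cintegral nu' h.

Lemma same_integralD h1 h2 : same_integral h1 -> same_integral h2 ->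
  same_integral (fun p => h1 p + h2 p).
Proof.
move=> [[r1 i1] e1] [[r2 i2] e2].
have RE : (fun p => complex.Re (h1 p + h2 p)) =
    fun p => complex.Re (h1 p) + complex.Re (h2 p).
  by apply/funext => p; exact: ReD.
have IE : (fun p => complex.Im (h1 p + h2 p)) =
    fun p => complex.Im (h1 p) + complex.Im (h2 p).
  by apply/funext => p; exact: ImD.
split; first by split; rewrite ?RE ?IE; exact: admissibleD.
rewrite /cintegral RE IE !RintegralD//; try exact: integrable_admissible.
by move: e1 e2 => [-> ->] [-> ->].
Qed.

Lemma same_integralZ (c : R[i]) h : same_integral h -> same_integral (fun p => c * h p).
Proof.
move=> [[r i] e]; split; first by apply: cadmissibleM => //; split; exact: admissible_cst.
have RE : (fun p => complex.Re (c * h p)) =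
    fun p => complex.Re c * complex.Re (h p) - complex.Im c * complex.Im (h p).
  by apply/funext => p; case: (c) (h p) => [? ?] [].
have IE : (fun p => complex.Im (c * h p)) =
    fun p => complex.Re c * complex.Im (h p) + complex.Im c * complex.Re (h p).
  by apply/funext => p; case: (c) (h p) => [? ?] [].
rewrite /cintegral RE IE.
rewrite !RintegralB//; try by apply: integrable_admissible => //; exact: admissibleZ.
rewrite !RintegralD//; try by apply: integrable_admissible => //; exact: admissibleZ.
rewrite !RintegralZl//; try exact: integrable_admissible.
by move: e => [-> ->].
Qed.

(** All monomial weights are included, so that multiplying [h] by z or by its conjugate only shifts
    [m] or [n]. *)
Definition moment_class h := forall m n : nat,
  same_integral (fun p => h p * (toC p ^+ m * (toC p)^* ^+ n)).

(** Equality of integrals does not pass to products, whereas maps preserving [moment_class] compose;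
    this makes the multipliers an algebra. *)
Definition multiplier h := forall h0, moment_class h0 -> moment_class (fun p => h p * h0 p).

Lemma moment_class1 : moment_class (fun=> 1).
Proof.
move=> m n; under eq_fun do rewrite mul1r.
by split; [exact: cadmissible_monomial|exact: moments].
Qed.

Lemma multiplierD h1 h2 : multiplier h1 -> multiplier h2 ->
  multiplier (fun p => h1 p + h2 p).
Proof.
move=> m1 m2 g Pg m n; under eq_fun do rewrite !mulrDl.
by apply: same_integralD; [exact: m1|exact: m2].
Qed.

Lemma multiplierM h1 h2 : multiplier h1 -> multiplier h2 ->
  multiplier (fun p => h1 p * h2 p).
Proof.
move=> m1 m2 g Pg m n; under eq_fun do rewrite -[_ * _ * g _]mulrA.
by apply: m1; exact: m2.
Qed.

Lemma multiplier_cst c : multiplier (fun=> c).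
Proof.
by move=> g Pg m n; under eq_fun do rewrite -mulrA; exact: same_integralZ.
Qed.

Lemma multiplierX h k : multiplier h -> multiplier (fun p => h p ^+ k).
Proof.
move=> mh; elim: k => [|k IH]; first exact: multiplier_cst.
under eq_fun do rewrite exprS; exact: multiplierM.
Qed.

Lemma multiplier_toC : multiplier (@toC R).
Proof.
move=> g Pg m n.
by under eq_fun => p do rewrite (mulrC (toC p)) -mulrA (mulrA (toC p)) -exprS.
Qed.

Lemma multiplier_conj : multiplier (fun p => (toC p)^*).
Proof.
move=> g Pg m n; under eq_fun => p.
  rewrite (mulrC _^*) -mulrA (mulrCA _^*) -exprS; over.
exact: Pg.
Qed.

Definition rmultiplier f := multiplier (fun p => (f p)%:C).

Lemma rmultiplierD f g : rmultiplier f -> rmultiplier g ->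
  rmultiplier (fun p => f p + g p).
Proof.
by rewrite /rmultiplier => mf mg; under eq_fun do rewrite rmorphD; exact: multiplierD.
Qed.

Lemma rmultiplierM f g : rmultiplier f -> rmultiplier g ->
  rmultiplier (fun p => f p * g p).
Proof.
by rewrite /rmultiplier => mf mg; under eq_fun do rewrite rmorphM; exact: multiplierM.
Qed.

Lemma rmultiplierX f k : rmultiplier f -> rmultiplier (fun p => f p ^+ k).
Proof.
by rewrite /rmultiplier => mf; under eq_fun do rewrite rmorphXn; exact: multiplierX.
Qed.

Lemma rmultiplier_cst c : rmultiplier (fun=> c).
Proof. exact: multiplier_cst. Qed.

Lemma rmultiplier_fst : rmultiplier fst.
Proof.
rewrite /rmultiplier (_ : (fun p => _) = fun p : plane R => 2^-1 * (toC p + (toC p)^*)).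
  apply: multiplierM; first exact: multiplier_cst.
  by apply: multiplierD; [exact: multiplier_toC|exact: multiplier_conj].
by apply/funext => p; rewrite addcJ mulrA mulVf ?mul1r// pnatr_eq0.
Qed.

Lemma rmultiplier_snd : rmultiplier snd.
Proof.
rewrite /rmultiplier (_ : (fun p => _) =
    fun p : plane R => (2 * 'i)^-1 * (toC p + (-1) * (toC p)^*)).
  apply: multiplierM; first exact: multiplier_cst.
  apply: multiplierD; first exact: multiplier_toC.
  by apply: multiplierM; [exact: multiplier_cst|exact: multiplier_conj].
apply/funext => p; rewrite mulN1r subcJ mulrAC mulrA mulVf ?mul1r//.
by rewrite mulf_neq0 ?pnatr_eq0// eq_complex/= oner_eq0 andbF.
Qed.

Lemma rmultiplier_step k f : rmultiplier f -> rmultiplier (fun p => step k (f p)).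
Proof.
move=> mf; rewrite /step; apply: rmultiplierD; first exact: rmultiplier_cst.
under eq_fun do rewrite -mulN1r; apply: rmultiplierM; first exact: rmultiplier_cst.
apply: rmultiplierX; apply: rmultiplierD; first exact: rmultiplier_cst.
under eq_fun do rewrite -mulN1r; apply: rmultiplierM; first exact: rmultiplier_cst.
exact: rmultiplierX.
Qed.

(** The multiplier is applied to the constant 1, with both exponents 0. Integrability lifts the
    equality of real integrals to the extended ones. *)
Lemma rmultiplier_integral f : rmultiplier f ->
  admissible f /\ (\int[nu]_p (f p)%:E = \int[nu']_p (f p)%:E)%E.
Proof.
move=> /(_ _ moment_class1 0%N 0%N).
under eq_fun do rewrite !expr0 !mulr1.
move=> [[af _]] [+ _]; rewrite /Rintegral => e; split => //.
have fE := integrable_fin_num measurableT (integrable_admissible nuS af).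
have fE' := integrable_fin_num measurableT (integrable_admissible nu'S af).
by rewrite -(fineK fE) -(fineK fE') e.
Qed.

End MomentProblem.

(** * Compactly supported probabilities are determined by their moments *)

Section Uniqueness.
Variable R : realType.

(** The plane carries the product sigma-algebra, so an open set is written as a countable union of
    products of rational balls. This makes the complement of a compact support measurable. *)
Lemma open_plane_measurable (U : set (R * R)) : open U -> measurable (U : set (plane R)).
Proof.
move=> oU.
pose box (q : rat * rat * nat) : set (plane R) :=
  ball (ratr q.1.1 : R) (q.2.+1%:R^-1) `*` ball (ratr q.1.2 : R) (q.2.+1%:R^-1).
have -> : U = \bigcup_(q in [set q | box q `<=` U]) box q.
  apply/seteqP; split; last by move=> p [q qU bqp]; exact: qU.
  move=> [x y] Uxy.
  have /nbhs_ballP[e /= e0 eU] : nbhs (x, y) U by exact: open_nbhs_nbhs.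
  have [n ne] : exists n, n.+1%:R^-1 < e / 2.
    exists (Num.truncn (2 / e)); rewrite invf_plt ?posrE ?divr_gt0// invf_div.
    exact: truncnS_gt.
  have n0 : 0 < (n.+1%:R^-1 : R) by rewrite invr_gt0.
  have rat_near (z : R) : exists q : rat, ball (ratr q : R) (n.+1%:R^-1) z.
    have [|q] := @rat_in_itvoo R (z - n.+1%:R^-1) (z + n.+1%:R^-1).
      by rewrite ltrBlDr -addrA ltrDl addr_gt0.
    rewrite in_itv/= => /andP[q1 q2]; exists q; rewrite /ball/= ltr_norml.
    by rewrite ltrBrDl q1 ltrBlDl.
  have ee : n.+1%:R^-1 + n.+1%:R^-1 <= e by rewrite [leRHS]splitr lerD// ltW.
  have [qx bqx] := rat_near x; have [qy bqy] := rat_near y.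
  exists (qx, qy, n) => //= -[u v] [/= bu bv]; apply: eU; split => /=.
    apply: (le_ball ee).
    exact: ball_triangle (ball_sym bqx) bu.
  apply: (le_ball ee).
  exact: ball_triangle (ball_sym bqy) bv.
rewrite bigcup_mkcond; apply: countable_bigcupT_measurable => // q.
case: ifPn => // _; apply: measurableX; exact: measurable_ball.
Qed.

(** Stated for all large [M], so that two measures can share one square. *)
Lemma compactly_supported_square (nu : probability (plane R) R) :
  compactly_supported nu -> exists M0, forall M, M0 <= M -> nu (~` square M) = 0%E.
Proof.
move=> [K [cK nuK]].
have mK : measurable (~` K : set (plane R)).
  apply: (@open_plane_measurable (~` K)); apply: closed_openC.
  exact: (@compact_closed _ K (@norm_hausdorff R (R * R)%type)).
have [M0 [_ KM]] := compact_bounded cK.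
(* The bound on the compact set is available only for numbers strictly above [M0]. *)
exists (M0 + 1) => M MM; apply: (subset_measure0 _ mK _ nuK).
  by apply: measurableC; exact: measurable_square.
apply: subsetC => p /(KM M)/=; rewrite /square/=.
have /[swap]/[apply] : M0 < M by lra.
by rewrite prod_normE ge_max => /andP.
Qed.

Lemma moments_unique (nu nu' : probability (plane R) R) :
  compactly_supported nu -> compactly_supported nu' ->
  (forall m n : nat,
    cintegral nu (fun p => toC p ^+ m * (toC p)^* ^+ n) =
    cintegral nu' (fun p => toC p ^+ m * (toC p)^* ^+ n)) ->
  forall E, measurable E -> nu E = nu' E.
Proof.
move=> /compactly_supported_square[M1 cM1] /compactly_supported_square[M2 cM2] mom.
pose M := Num.max (Num.max M1 M2) 0.
have M0 : 0 <= M by rewrite /M le_max lexx orbT.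
have nuS : nu (~` square M) = 0%E by apply: cM1; rewrite /M !le_max lexx.
have nu'S : nu' (~` square M) = 0%E by apply: cM2; rewrite /M !le_max lexx orbT.
apply: quadrant_measure_unique => a b.
(* An increasing affine map sending [c] to 1/2 and [-M, M] into [0, 1], because |x - c| <= M + |c|;
   the [+ 1] keeps the denominator positive. Thus [step k] of it tends to the indicator of the open
   ray x > c. *)
pose scale (c x : R) := (2 * (M + `|c|) + 1)^-1 * (x - c) + 2^-1.
have L0 (c : R) : 0 < 2 * (M + `|c|) + 1.
  by rewrite ltr_wpDl// mulr_ge0// addr_ge0.
have scale01 c x : `|x| <= M -> 0 <= scale c x <= 1.
  move=> xM; have : `|x - c| <= M + `|c| by rewrite (le_trans (ler_normB _ _))// lerD2r.
  rewrite ler_norml => /andP[h1 h2].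
  have h : - 2^-1 <= (2 * (M + `|c|) + 1)^-1 * (x - c) <= 2^-1.
    by rewrite mulrC ler_pdivlMr// ler_pdivrMr//; apply/andP; split; lra.
  by rewrite /scale; move: h; set t := _ * _ => /andP[? ?]; apply/andP; split; lra.
have scale_half c x : (scale c x <= 2^-1) = (x <= c).
  by rewrite /scale gerDr pmulr_rle0 ?invr_gt0// subr_le0.
have cvg_scale c x : `|x| <= M -> step k (scale c x) @[k --> \oo] --> ((c < x)%R%:R : R).
  move=> /(scale01 c)/andP[s0 s1]; have := scale_half c x; case: ltP => cx sE.
    by apply: cvg_step1 => //; rewrite ltNge sE.
  by apply: cvg_step0 => //; rewrite sE.
pose f k (p : plane R) : R := step k (scale a p.1) * step k (scale b p.2).
have rmultiplier_scale (c : R) (g : plane R -> R) : rmultiplier M nu nu' g ->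
    rmultiplier M nu nu' (fun p => scale c (g p)).
  move=> mg; rewrite /scale.
  apply: (rmultiplierD nuS nu'S); last exact: (rmultiplier_cst nuS nu'S).
  apply: rmultiplierM; first exact: (rmultiplier_cst nuS nu'S).
  by apply: (rmultiplierD nuS nu'S) => //; exact: (rmultiplier_cst nuS nu'S).
have fP k : rmultiplier M nu nu' (f k).
  apply: rmultiplierM; apply: (rmultiplier_step nuS nu'S); apply: rmultiplier_scale.
    exact: (rmultiplier_fst nuS nu'S).
  exact: (rmultiplier_snd nuS nu'S).
have fi k := rmultiplier_integral nuS nu'S mom (fP k).
have mQ : measurable (`]a, +oo[ `*` `]b, +oo[ : set (plane R)).
  by apply: measurableX; exact: measurable_itv.
have cvg_f (m : probability (plane R) R) : m (~` square M) = 0%E ->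
    (\int[m]_p (f k p)%:E @[k --> \oo] --> m (`]a, +oo[ `*` `]b, +oo[))%E.
  move=> mS; rewrite -[X in _ --> m X]setIT -integral_indic//.
  have [] // := @dominated_convergence _ _ _ m setT measurableT
     (fun k p => (f k p)%:E) (fun p => (\1_(`]a, +oo[ `*` `]b, +oo[) p)%:E) (cst 1%E).
  - by move=> k; apply/measurable_EFinP; case: (fi k) => -[].
  - exact/measurable_EFinP/measurable_indic.
  - apply: filterS (ae_square mS) => p [p1 p2] _; apply: cvg_EFin.
      exact: nearW.
    rewrite (_ : \1__ p = (a < p.1)%R%:R * (b < p.2)%R%:R).
      by apply: cvgM; exact: cvg_scale.
    rewrite indicE -natrM mulnb; congr ((nat_of_bool _)%:R).
    by apply/idP/andP => [/set_mem|pQ]; last apply/mem_set; rewrite /= !in_itv/= !andbT.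
  - exact: finite_measure_integrable_cst.
  - apply: filterS (ae_square mS) => p [p1 p2] k _; rewrite lee_fin ger0_norm.
      by rewrite mulr_ile1// ?step_ge0 ?step_le1// scale01.
    by rewrite mulr_ge0// step_ge0// scale01.
apply: (@cvg_unique _ (@ereal_hausdorff R) (\int[nu]_p (f k p)%:E @[k --> \oo])%E).
  exact: cvg_f.
have -> : (fun k => \int[nu]_p (f k p)%:E)%E = (fun k => \int[nu']_p (f k p)%:E)%E.
  by apply/funext => k; case: (fi k).
exact: cvg_f.
Qed.

End Uniqueness.
(** * Existence of the spectral measures *)

Section Densities.
Local Open Scope ereal_scope.
Import HBNNSimple.

(** Serves both for image measures, with [w = 1], and for image measures with a density. The
    hypothesis on [kap] is the case of indicators; simple functions and monotone limits follow. *)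
Lemma ge0_integral_transfer d1 d2 (X : measurableType d1) (Y : measurableType d2)
    (R : realType) (lam : {measure set X -> \bar R}) (kap : {measure set Y -> \bar R})
    (D : set X) (phi : X -> Y) (w : X -> R) (h : Y -> \bar R) :
  measurable D -> measurable_fun setT phi -> measurable_fun D w ->
  (forall x, D x -> 0 <= w x)%R ->
  (forall E, measurable E -> kap E = \int[lam]_(x in D) ((\1_E (phi x) * w x)%R)%:E) ->
  measurable_fun setT h -> (forall y, 0 <= h y) ->
  \int[kap]_y h y = \int[lam]_(x in D) (h (phi x) * (w x)%:E).
Proof.
move=> mD mphi mw w0 kapE mh h0.
have mphiD (g : Y -> R) : measurable_fun setT g -> measurable_fun D (g \o phi).
  by move=> mg; apply: (measurableT_comp mg); exact: measurable_funTS.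
have indE (r : R) (A : set Y) : measurable A -> (0 <= r)%R ->
    \int[kap]_y ((r * \1_A y)%R)%:E =
    \int[lam]_(x in D) ((r * \1_A (phi x) * w x)%R)%:E.
  move=> mA r0; have mi : measurable_fun setT (\1_A : Y -> R) by exact: measurable_indic.
  under eq_integral do rewrite EFinM.
  rewrite ge0_integralZl//; last exact/measurable_EFinP.
  rewrite integral_indic// setIT kapE// -ge0_integralZl//.
  - by apply: eq_integral => x _; rewrite -EFinM mulrA.
  - by apply/measurable_EFinP/measurable_funM => //; exact: mphiD.
  - by move=> x Dx; rewrite lee_fin mulr_ge0// w0.
have nnE (g : {nnsfun Y >-> R}) :
    \int[kap]_y (g y)%:E = \int[lam]_(x in D) ((g (phi x) * w x)%R)%:E.
  under eq_integral do rewrite fimfunE -fsumEFin//.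
  rewrite ge0_integral_fsum//; last 2 first.
  - by move=> r; exact/measurable_EFinP/measurableT_comp.
  - by move=> n y _; rewrite EFinM nnfun_muleindic_ge0.
  under [RHS]eq_integral => x _.
    rewrite fimfunE mulr_fsuml -fsumEFin//; over.
  rewrite ge0_integral_fsum//; last 2 first.
  - move=> r; apply/measurable_EFinP/measurable_funM => //.
    by apply: (mphiD (fun y => r * \1_(g @^-1` [set r]) y)%R); exact: measurable_funM.
  - move=> r x Dx; rewrite lee_fin mulr_ge0 ?w0//.
    by rewrite -lee_fin EFinM nnfun_muleindic_ge0.
  apply: eq_fsbigr => r /set_mem[y _ <-]; exact: indE.
pose g := nnsfun_approx measurableT mh.
have gh y : (g n y)%:E @[n --> \oo] --> h y by apply: cvg_nnsfun_approx.
transitivity (lim (\int[kap]_y (g n y)%:E @[n --> \oo])).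
  rewrite -monotone_convergence//=.
  - by apply: eq_integral => y _; apply/esym/cvg_lim => //; exact: gh.
  - by move=> n; exact/measurable_EFinP/measurable_funTS.
  - by move=> n y _; rewrite lee_fin.
  - by move=> y _ m n mn; rewrite lee_fin; exact/lefP/nd_nnsfun_approx.
under eq_fun do rewrite nnE.
rewrite -monotone_convergence//=.
- apply: eq_integral => x _; apply: cvg_lim => //.
  under eq_fun do rewrite EFinM.
  by apply: cvgeZr => //; exact: gh.
- by move=> n; apply/measurable_EFinP/measurable_funM => //; exact: mphiD.
- by move=> n x Dx; rewrite lee_fin mulr_ge0// w0.
- move=> x Dx m n mn; rewrite lee_fin ler_wpM2r ?w0//.
  exact/lefP/nd_nnsfun_approx.
Qed.

(** Multiplying by a nonnegative [w] commutes with taking positive and negative parts, so both sides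
    are the same difference of nonnegative integrals, even infinite ones. *)
Lemma integral_transfer d1 d2 (X : measurableType d1) (Y : measurableType d2)
    (R : realType) (lam : {measure set X -> \bar R}) (kap : {measure set Y -> \bar R})
    (D : set X) (phi : X -> Y) (w : X -> R) (h : Y -> R) :
  measurable D -> measurable_fun setT phi -> measurable_fun D w ->
  (forall x, D x -> 0 <= w x)%R ->
  (forall E, measurable E -> kap E = \int[lam]_(x in D) ((\1_E (phi x) * w x)%R)%:E) ->
  measurable_fun setT h ->
  \int[kap]_y (h y)%:E = \int[lam]_(x in D) ((h (phi x) * w x)%R)%:E.
Proof.
move=> mD mphi mw w0 kapE mh; have mEh : measurable_fun setT (EFin \o h).
  exact/measurable_EFinP.
rewrite integralE [RHS]integralE.
rewrite !(ge0_integral_transfer mD mphi mw w0 kapE)//; last 2 first.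
  exact: measurable_funeneg.
  exact: measurable_funepos.
congr (_ - _); apply: eq_integral => x /set_mem Dx.
  by rewrite !funeposE -!EFin_max -EFinM maxr_pMl ?w0// mul0r.
by rewrite !funenegE -!EFinN -!EFin_max -EFinM maxr_pMl ?w0// mul0r mulNr.
Qed.

Lemma density_probability d (T : measurableType d) (R : realType)
    (m : {measure set T -> \bar R}) (g : T -> R) :
  measurable_fun setT g -> (forall x, 0 <= g x)%R ->
  \int[m]_x (g x)%:E = 1 ->
  exists nu : probability T R, forall E, nu E = \int[m]_(x in E) (g x)%:E.
Proof.
move=> mg g0 g1; pose nu E := \int[m]_(x in E) (g x)%:E.
have nu0 : nu set0 = 0 by rewrite /nu integral_set0.
have nu_ge0 E : 0 <= nu E by apply: integral_ge0 => x _; rewrite lee_fin.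
have nuS : semi_sigma_additive nu.
  move=> F mF tF mUF; rewrite /nu; apply: cvg_toP.
    apply: ereal_nondecreasing_is_cvgn => i j ij.
    by apply: lee_sum_nneg_natr => // k _ _; exact: nu_ge0.
  rewrite ge0_integral_bigcup//=.
    by apply: measurable_funTS; exact/measurable_EFinP.
  by move=> x _; rewrite lee_fin.
pose Mnu := isMeasure.Build _ _ _ nu nu0 nu_ge0 nuS.
pose mnu : {measure set T -> \bar R} := HB.pack nu Mnu.
pose Pnu := @Measure_isProbability.Build _ _ R mnu g1.
pose pnu : probability T R := HB.pack nu Mnu Pnu.
by exists pnu.
Qed.

(** The set function in the conclusion has the shape of [dr_dtheta] and [arc_length]; it is
    convertible to the measure [m] of the proof, an image of a restriction of [lam]. *)
Lemma pushed_density d1 d2 (X : measurableType d1) (Y : measurableType d2)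
    (R : realType) (lam : {measure set X -> \bar R})
    (D : set X) (phi : X -> Y) (g : Y -> R) :
  measurable D -> measurable_fun setT phi -> measurable_fun setT g ->
  (forall y, 0 <= g y)%R ->
  \int[lam]_(x in D) (g (phi x))%:E = 1 ->
  exists nu : probability Y R,
    (forall E, nu E = \int[pushforward (fun F => lam (F `&` D)) phi]_(y in E) (g y)%:E) /\
    forall h : Y -> R, measurable_fun setT h ->
      \int[nu]_y (h y)%:E = \int[lam]_(x in D) ((h (phi x) * g (phi x))%R)%:E.
Proof.
move=> mD mphi mg g0 g1.
pose m' : {measure set Y -> \bar R} := pushforward (mrestr lam mD) phi.
pose m := m' mphi.
have mE E : measurable E -> m E = \int[lam]_(x in D) ((\1_E (phi x) * 1)%R)%:E.
  move=> mEE; under eq_integral => x _ do rewrite mulr1.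
  have -> : m E = lam ((phi @^-1` E) `&` D) by [].
  rewrite -integral_indic// -[X in measurable X]setTI.
  exact: (mphi measurableT).
have mI (h : Y -> R) : measurable_fun setT h ->
    \int[m]_y (h y)%:E = \int[lam]_(x in D) (h (phi x))%:E.
  move=> mh; rewrite (integral_transfer mD mphi _ _ mE)//.
  by under eq_integral do rewrite mulr1.
have [nu nuE] : exists nu : probability Y R, forall E, nu E = \int[m]_(x in E) (g x)%:E.
  by apply: density_probability => //; rewrite mI.
exists nu; split; first exact: nuE.
move=> h mh; apply: integral_transfer => //.
- by apply: (measurableT_comp mg); exact: measurable_funTS.
- move=> E mEE; transitivity (\int[m]_(x in E) (g x)%:E); first exact: nuE.
  rewrite integral_mkcond.
  rewrite -(mI (fun y => \1_E y * g y)%R); last exact: measurable_funM.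
  apply: eq_integral => y _; rewrite patchE indicE.
  by case: ifPn => _; rewrite ?mul1r ?mul0r.
Qed.

End Densities.

(** * Angular integrals *)

Section Calculus.
Variable R : realType.
Local Notation mu := (@lebesgue_measure R).

Lemma is_derive_continuous (F : R -> R) (x d : R) :
  is_derive x 1 F d -> {for x, continuous F}.
Proof. by move=> [dF _]; apply/differentiable_continuous/derivable1_diffP. Qed.

Lemma FTC_segment (f F : R -> R) (a b : R) : a < b ->
  {in `[a, b], forall x : R, is_derive x 1 F (f x)} ->
  {in `[a, b], forall x : R, {for x, continuous f}} ->
  (\int[mu]_(x in `[a, b]) (f x)%:E = (F b - F a)%:E)%E.
Proof.
move=> ab dF cf; rewrite EFinB; apply: continuous_FTC2 => //.
- by apply: continuous_in_subspaceT => x /set_mem; exact: cf.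
- split.
  + move=> x xab; have [] // := dF x _.
    by apply: subset_itv_oo_cc xab.
  + apply: cvg_at_right_filter; apply: (is_derive_continuous (dF a _)).
    by rewrite in_itv/= lexx ltW.
  + apply: cvg_at_left_filter; apply: (is_derive_continuous (dF b _)).
    by rewrite in_itv/= lexx ltW.
- move=> x xab; rewrite derive1E.
  by have [_ ->] := dF x (subset_itv_oo_cc xab).
Qed.

Definition cis (t : R) : R[i] := (cos t +i* sin t)%C.

Lemma cisD (s t : R) : cis (s + t) = cis s * cis t.
Proof. by rewrite /cis cosD sinD; apply/eqP; rewrite eq_complex /= eqxx addrC mulrC/=. Qed.

Lemma cisX (t : R) m : cis t ^+ m = cis (m%:R * t).
Proof.
elim: m => [|m IH]; first by rewrite expr0 mul0r /cis cos0 sin0.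
by rewrite exprS IH -cisD -natr1 mulrDl mul1r addrC.
Qed.

Lemma conj_cis (t : R) : (cis t)^* = cis (- t).
Proof. by rewrite /cis cosN sinN. Qed.

Lemma toC_polar (r t : R) : toC (polar (r, t)) = r%:C%C * cis t.
Proof.
rewrite /toC /polar /cis /=; apply/eqP.
by rewrite eq_complex /= !mul0r subr0 addr0 !eqxx.
Qed.

Lemma monomial_polar (r t : R) m n :
  toC (polar (r, t)) ^+ m * (toC (polar (r, t)))^* ^+ n =
  ((r ^+ (m + n) * cos ((m%:R - n%:R) * t)) +i* (r ^+ (m + n) * sin ((m%:R - n%:R) * t)))%C.
Proof.
rewrite toC_polar rmorphM/= conj_cis [(r%:C%C)^*]conjc_real !exprMn !cisX mulrACA -cisD.
rewrite -exprD -rmorphXn /= mulrN -mulrBl /cis.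
by apply/eqP; rewrite eq_complex /= !mul0r subr0 addr0 !eqxx.
Qed.

(** Makes the antiderivatives of the nonconstant angular factors agree at 0 and at 2 pi. *)
Lemma cis_2pi (m n : nat) : cis ((m%:R - n%:R) * (2 * pi)) = 1.
Proof.
have c1 : cis (2 * pi) = 1 by rewrite mulr_natl /cis cos2pi sin2pi.
rewrite mulrBl cisD -cisX c1 expr1n mul1r -conj_cis -cisX c1 expr1n.
by rewrite rmorph1.
Qed.

Lemma is_derive_scale (f : R -> R) (c x d : R) : is_derive (c * x) 1 f d ->
  is_derive x 1 (fun y => f (c * y)) (c * d).
Proof.
move=> df; rewrite mulrC; apply: (@is_derive1_comp _ f (fun y => c * y)) => //.
by apply: is_derive_eq; rewrite /GRing.scale/= mulr1.
Qed.

Lemma integral_cos (m n : nat) :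
  (\int[mu]_(t in `[0%R, (2 * pi)%R[) (cos ((m%:R - n%:R) * t))%:E =
   (if m == n then 2 * pi else 0)%:E)%E.
Proof.
have pi0 : 0 < 2 * pi :> R by rewrite mulr_gt0 ?pi_gt0.
have [->|mn] := eqVneq m n.
  under eq_integral do rewrite subrr mul0r cos0.
  rewrite integral_cst//= lebesgue_measure_itv/= lte_fin pi0 mul1e.
  by rewrite -EFinB subr0.
set c : R := m%:R - n%:R.
have c0 : c != 0 by rewrite subr_eq0 eqr_nat.
have ccos : continuous (fun t : R => cos (c * t)).
  by move=> t; apply: (is_derive_continuous (is_derive_scale (is_derive_cos _))).
rewrite integral_itv_bndo_bndc; last first.
  apply/measurable_EFinP; apply: measurable_funTS.
  exact: continuous_measurable_fun.
rewrite (@FTC_segment _ (fun t => c^-1 * sin (c * t)))//.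
  have := cis_2pi m n; rewrite -/c => -[_ ->].
  by rewrite !mulr0 sin0 mulr0 subrr.
  move=> t _; have := is_deriveZ c^-1 (is_derive_scale (is_derive_sin (c * t))).
  by rewrite /GRing.scale/= mulrA mulVf// mul1r.
by move=> t _; exact: ccos.
Qed.

Lemma integral_sin (m n : nat) :
  (\int[mu]_(t in `[0%R, (2 * pi)%R[) (sin ((m%:R - n%:R) * t))%:E = 0)%E.
Proof.
have pi0 : 0 < 2 * pi :> R by rewrite mulr_gt0 ?pi_gt0.
have [->|mn] := eqVneq m n.
  under eq_integral do rewrite subrr mul0r sin0.
  by rewrite integral0.
set c : R := m%:R - n%:R.
have c0 : c != 0 by rewrite subr_eq0 eqr_nat.
have csin : continuous (fun t : R => sin (c * t)).
  by move=> t; apply: (is_derive_continuous (is_derive_scale (is_derive_sin _))).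
rewrite integral_itv_bndo_bndc; last first.
  apply/measurable_EFinP; apply: measurable_funTS.
  exact: continuous_measurable_fun.
rewrite (@FTC_segment _ (fun t => (- c^-1) * cos (c * t)))//.
  have := cis_2pi m n; rewrite -/c => -[-> _].
  by rewrite mulr0 cos0 subrr.
  move=> t _; have := is_deriveZ (- c^-1) (is_derive_scale (is_derive_cos (c * t))).
  by rewrite /GRing.scale/= !mulrN mulNr opprK mulrA mulVf// mul1r.
by move=> t _; exact: csin.
Qed.

End Calculus.

(** * Radial integrals *)

Section RadialMoments.
Variable R : realType.
Local Notation mu := (@lebesgue_measure R).

(** Handles an [f] that blows up at [b], as [weight] does at 2: monotone convergence along the
    segments [[a, c n]] involves [F] at [b] only through its left limit. *)
Lemma FTC_itvco (f F : R -> R) (a b : R) : a < b ->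
  {in `[a, b[, forall x : R, is_derive x 1 F (f x)} ->
  {in `[a, b[, forall x : R, {for x, continuous f}} ->
  {in `[a, b[, forall x : R, 0 <= f x} ->
  F x @[x --> b^'-] --> F b ->
  (\int[mu]_(x in `[a, b[) (f x)%:E = (F b - F a)%:E)%E.
Proof.
move=> ab dF cf f0 Fb.
(* The shift to [n.+2] keeps [c 0] strictly above [a]. *)
pose c (n : nat) : R := b - (b - a) / n.+2%:R.
have n0 n : 0 < (b - a) / n.+2%:R by rewrite divr_gt0// subr_gt0.
have cb n : c n < b by rewrite /c ltrBlDr ltrDl.
have ac n : a < c n.
  by rewrite ltrBrDr -ltrBrDl ltr_pdivrMr// ltr_pMr ?subr_gt0// ltr1n.
have sub n x : x \in `[a, c n] -> x \in `[a, b[.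
  by rewrite !in_itv/= => /andP[->]/= /le_lt_trans; apply.
have c_cvg : c n @[n --> \oo] --> b.
  rewrite /c -[X in _ --> X]subr0; apply: cvgB; first exact: cvg_cst.
  rewrite -(mulr0 (b - a)); apply: cvgM; first exact: cvg_cst.
  by rewrite (cvg_shiftS (@harmonic R)); exact: cvg_harmonic.
have itvE : `[a, b[%classic = \bigcup_n `[a, c n]%classic.
  apply/seteqP; split => x /=; last by move=> [n _ /= /sub].
  rewrite in_itv/= => /andP[ax xb].
  have : \forall n \near \oo, x < c n by apply: (cvgr_gt b c_cvg).
  by move=> [n _ /(_ n (leqnn _)) xn]; exists n => //=; rewrite in_itv/= ax ltW.
have := @ge0_nondecreasing_set_cvg_integral _ (measurableTypeR R) R (fun n => `[a, c n]%classic)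
  (fun x => (f x)%:E) mu.
rewrite -itvE => cvg1.
apply: (@cvg_unique _ (@ereal_hausdorff R)
  (\int[mu]_(x in `[a, c n]) (f x)%:E @[n --> \oo])%E).
  apply: cvg1.
  - move=> m n mn; apply/subsetPset => x /=; rewrite !in_itv/= => /andP[-> /=].
    move=> /le_trans; apply; rewrite lerD2l lerN2 ler_pM2l ?subr_gt0//.
    by rewrite lef_pV2 ?posrE// ler_nat.
  - by move=> n; exact: measurable_itv.
  - move=> n; apply/measurable_EFinP; apply: subspace_continuous_measurable_fun => //.
    by apply: continuous_in_subspaceT => x /set_mem/sub; exact: cf.
  - by move=> n x /sub; rewrite lee_fin; exact: f0.
have -> : (fun n => \int[mu]_(x in `[a, c n]) (f x)%:E)%E = (fun n => (F (c n) - F a)%:E).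
  apply/funext => n; apply: FTC_segment => // x /sub; [exact: dF|exact: cf].
apply: cvg_EFin; first exact: nearW.
apply: cvgB; last exact: cvg_cst.
have /cvg_at_leftP := Fb; apply; split => //.
Qed.

Lemma asin1 : asin 1 = pi / 2 :> R.
Proof.
rewrite -[X in asin X]sin_pihalf sinK// in_itv/= lexx andbT.
by have := pi_gt0 R; lra.
Qed.

Lemma asin_cvg_left : asin (x / 2) @[x --> (2 : R)^'-] --> (pi / 2 : R).
Proof.
apply/cvgrPdist_lt => e e0.
(* [d <= pi] keeps [pi / 2 - d] in the interval where [sin] is increasing, so the bound
   [2 * sin (pi / 2 - d) < x] can be inverted by [asin]. *)
have [d [d0 dpi de]] : exists d : R, [/\ 0 < d, d <= pi & d <= e].
  by exists (Num.min e pi); rewrite lt_min e0 pi_gt0 !ge_min !lexx orbT.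
have pi0 : 0 < pi :> R := pi_gt0 R.
have s1 : sin (pi / 2 - d) < 1.
  rewrite -[X in _ < X]sin_pihalf ltr_sin; [by lra| |]; rewrite in_itv/=; apply/andP; split; lra.
near=> x.
have x2 : x < 2 by near: x; exact: nbhs_left_lt.
have x0 : 0 < x by near: x; apply: nbhs_left_gt.
have xs : 2 * sin (pi / 2 - d) < x by near: x; apply: nbhs_left_gt; lra.
have x21 : -1 <= x / 2 <= 1 by apply/andP; split; lra.
have a1 := asin_lepi2 x21; have a2 := asin_geNpi2 x21.
have a3 : pi / 2 - d < asin (x / 2).
  rewrite -ltr_sin; [|by rewrite in_itv/=; apply/andP; split; lra|by rewrite in_itv/= a1 a2].
  by rewrite asinK ?in_itv//=; lra.
rewrite ger0_norm; last by lra.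
lra.
Unshelve. all: by end_near. Qed.

(** For |x| >= 2 the square root is 0, hence so is this inverse, by convention. *)
Definition weight (x : R) : R := (Num.sqrt (4 - x ^+ 2))^-1.

(* Integrating x^(2m) weight(x) by parts, since the derivative of
   x^(2m-1) sqrt(4 - x^2) is (4 (2m - 1) x^(2m-2) - 2m x^(2m)) weight(x). *)
Fixpoint antideriv (m : nat) (x : R) : R :=
  if m is m'.+1 then
    (m.*2%:R)^-1 * (4 * (m'.*2.+1)%:R * antideriv m' x - x ^+ m'.*2.+1 * Num.sqrt (4 - x ^+ 2))
  else asin (x / 2).

Lemma is_derive_funB (f g : R -> R) (x df dg : R) : is_derive x 1 f df ->
  is_derive x 1 g dg -> is_derive x 1 (fun y => f y - g y) (df - dg).
Proof. exact: is_deriveB. Qed.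

Lemma is_derive_funM (f g : R -> R) (x df dg : R) : is_derive x 1 f df ->
  is_derive x 1 g dg -> is_derive x 1 (fun y => f y * g y) (f x * dg + g x * df).
Proof. exact: is_deriveM. Qed.

Lemma is_derive_pow n (x : R) : is_derive x 1 (fun y => y ^+ n) (n%:R * x ^+ n.-1).
Proof.
have := is_deriveX n (is_derive_id x (1 : R)).
by rewrite exprfctE /GRing.scale/= mulr1.
Qed.

Lemma is_derive_sqrt4 (x : R) : -2 < x < 2 ->
  is_derive x 1 (fun y => Num.sqrt (4 - y ^+ 2)) (- x * weight x).
Proof.
move=> /andP[x1 x2]; have p : 0 < 4 - x ^+ 2 by nra.
have d1 := is_derive_funB (is_derive_cst (4 : R) x 1) (is_derive_pow 2 x).
have := @is_derive1_comp _ Num.sqrt (fun y => 4 - y ^+ 2) x _ _ (is_derive1_sqrt p) d1.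
rewrite /comp => h; apply: is_derive_eq h _.
rewrite /weight sub0r expr1 invfM mulrN mulrC mulrA mulNr; congr (- (_ * _)).
by rewrite mulrAC mulfV ?mul1r// pnatr_eq0.
Qed.

Lemma is_derive_antideriv m (x : R) : -2 < x < 2 ->
  is_derive x 1 (antideriv m) (x ^+ m.*2 * weight x).
Proof.
move=> x2; have p : 0 < 4 - x ^+ 2 by move: x2 => /andP[? ?]; nra.
elim: m => [|m IH].
  rewrite double0 expr0 mul1r /antideriv.
  have x21 : -1 < 2^-1 * x < 1 by move: x2 => /andP[? ?]; apply/andP; split; lra.
  have := is_derive_scale (is_derive1_asin x21).
  rewrite (_ : (fun y : R => asin (2^-1 * y)) = fun y => asin (y / 2)); last first.
    by apply/funext => y; rewrite mulrC.
  move=> h; apply: is_derive_eq h _; rewrite /weight.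
  rewrite (_ : 4 - x ^+ 2 = 2 ^+ 2 * (1 - (2^-1 * x) ^+ 2)); last by field.
  by rewrite sqrtrM ?sqr_ge0// sqrtr_sqr ger0_norm// invfM.
have := is_derive_funM (is_derive_cst (m.+1.*2%:R^-1 : R) x 1)
  (is_derive_funB (is_derive_funM (is_derive_cst (4 * (m.*2.+1)%:R : R) x 1) IH)
    (is_derive_funM (is_derive_pow m.*2.+1 x) (is_derive_sqrt4 x2))).
move=> h; apply: is_derive_eq h _; rewrite !mulr0 !addr0 /weight /=.
set s := Num.sqrt _; have s0 : s != 0 by rewrite gt_eqF// sqrtr_gt0.
(* Writing s as (4 - x^2) / s and then generalizing 1 / s removes the root, leaving a rational
   identity for [field]. *)
have s2 : s = (4 - x ^+ 2) / s by rewrite -[in X in X / _](sqr_sqrtr (ltW p)) expr2 mulfK.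
have m0 : (m.*2%:R + 2 : R) != 0 by rewrite gt_eqF// ltr_wpDl.
move: s2; move: (s^-1) => i ->; rewrite doubleS !exprS -!natr1.
field.
by apply: contra_neq m0 => <-; ring.
Qed.

Lemma antideriv0 m : antideriv m 0 = 0.
Proof.
elim: m => [|m IH] /=; last by rewrite IH mulr0 exprS !mul0r subr0 mulr0.
by rewrite mul0r -[X in asin X]sin0 sinK// in_itv/= oppr_le0 divr_ge0// pi_ge0.
Qed.

(** At 2 the square root kills the boundary term. What remains is the factor 4(2m + 1) / (2m + 2),
    by which the central binomial coefficients grow. *)
Lemma antideriv2 m : antideriv m 2 = pi / 2 * 'C(m.*2, m)%:R.
Proof.
elim: m => [|m IH] /=.
  by rewrite divff// asin1 bin0 mulr1.
rewrite (_ : 4 - 2 ^+ 2 = 0); last by ring.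
rewrite sqrtr0 mulr0 subr0 IH.
have e : (m.+1 * 'C(m.+1.*2, m.+1) = 2 * (m.*2.+1) * 'C(m.*2, m))%N.
  rewrite doubleS -mul_bin_diag /= -doubleS -mul2n -!mulnA; congr (2 * _)%N.
  rewrite (mul_bin_down m.*2.+1 m); congr (_ * _)%N; lia.
have := congr1 (fun n => n%:R : R) e; rewrite !natrM => eR.
have m0 : (m.+1%:R : R) != 0 by rewrite pnatr_eq0.
have -> : m.+1.*2%:R = 2 * m.+1%:R :> R by rewrite -mul2n natrM.
apply: (mulfI m0); rewrite [in RHS]mulrCA eR; field.
by rewrite addrC natr1.
Qed.

Lemma antideriv_cvg m : antideriv m x @[x --> (2 : R)^'-] --> antideriv m 2.
Proof.
elim: m => [|m IH] /=.
  by rewrite divff// asin1; exact: asin_cvg_left.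
apply: cvgM; first exact: cvg_cst.
apply: cvgB; first by apply: cvgM; [exact: cvg_cst|exact: IH].
apply: cvg_at_left_filter.
apply: cvgM; first exact: exprn_continuous.
apply: (@continuous_comp _ _ _ (fun x : R => 4 - x ^+ 2) Num.sqrt); last exact: sqrt_continuous.
by apply: cvgB; [exact: cvg_cst|exact: exprn_continuous].
Qed.

Lemma weight_continuous (x : R) : -2 < x < 2 -> {for x, continuous weight}.
Proof.
move=> /andP[x1 x2]; have p : 0 < 4 - x ^+ 2 by nra.
apply: cvgV; first by rewrite gt_eqF// sqrtr_gt0.
apply: (@continuous_comp _ _ _ (fun x : R => 4 - x ^+ 2) Num.sqrt); last exact: sqrt_continuous.
by apply: cvgB; [exact: cvg_cst|exact: exprn_continuous].
Qed.

Lemma radial_moment m :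
  (\int[mu]_(x in `[0%R, 2%R[) (x ^+ m.*2 * weight x)%:E =
   (pi / 2 * 'C(m.*2, m)%:R)%:E)%E.
Proof.
have sub (x : R) : x \in `[0, 2[ -> -2 < x < 2.
  by rewrite in_itv/= => /andP[x0 ->]; rewrite andbT; lra.
rewrite (@FTC_itvco _ (antideriv m)).
- by rewrite antideriv0 antideriv2 subr0.
- by [].
- by move=> x /sub; exact: is_derive_antideriv.
- move=> x /sub x2; apply: cvgM; first exact: exprn_continuous.
  exact: weight_continuous.
- by move=> x; rewrite in_itv/= => /andP[x0 _]; rewrite mulr_ge0 ?exprn_ge0// invr_ge0.
- exact: antideriv_cvg.
Qed.

End RadialMoments.

(** * Measurability, integrability and Fubini for products *)

Section PolarIntegrals.
Variable R : realType.
Local Notation mu := (@lebesgue_measure R).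
Local Open Scope ereal_scope.

(** Inversion is not continuous at 0, but on nonnegative reals it is the measurable power of
    exponent -1, with the same value 0 at 0. *)
Lemma measurable_inv_ge0 d (T : measurableType d) (f : T -> R) :
  measurable_fun setT f -> (forall x, 0 <= f x)%R ->
  measurable_fun setT (fun x => (f x)^-1)%R.
Proof.
move=> mf f0; under eq_fun do rewrite -powR_inv1//.
by apply: (@measurableT_comp _ _ _ _ _ _ (@powR R ^~ (-1)%R)) => //; exact: measurable_powR.
Qed.

Lemma measurable_sqrt_comp d (T : measurableType d) (f : T -> R) :
  measurable_fun setT f -> measurable_fun setT (fun x => Num.sqrt (f x)).
Proof.
move=> mf; apply: (@measurableT_comp _ _ _ _ _ _ (@Num.sqrt R)) => //.
by apply: continuous_measurable_fun; exact: sqrt_continuous.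
Qed.

Lemma measurable_weight : measurable_fun setT (@weight R).
Proof.
apply: measurable_inv_ge0; last by move=> x; rewrite sqrtr_ge0.
by apply: measurable_sqrt_comp; exact: measurable_funB.
Qed.

Lemma weight_ge0 (x : R) : (0 <= weight x)%R.
Proof. by rewrite invr_ge0 sqrtr_ge0. Qed.

Lemma integral_product_fun (U V : R -> R) (u v : R) :
  mu.-integrable setT (EFin \o U) -> mu.-integrable setT (EFin \o V) ->
  \int[mu]_x (U x)%:E = u%:E -> \int[mu]_x (V x)%:E = v%:E ->
  \int[mu \x mu]_(p in setT) (U p.1 * V p.2)%:E = (u * v)%:E.
Proof.
move=> iU iV Uu Vv.
have mU : measurable_fun setT U by apply/measurable_EFinP; case/integrableP: iU.
have mV : measurable_fun setT V by apply/measurable_EFinP; case/integrableP: iV.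
have mUV : measurable_fun setT (fun p : plane R => (U p.1 * V p.2)%:E).
  apply/measurable_EFinP; apply: measurable_funM.
    exact: (measurableT_comp mU (@measurable_fst _ _ _ _)).
  exact: (measurableT_comp mV (@measurable_snd _ _ _ _)).
have iUV : (mu \x mu).-integrable setT (fun p : plane R => (U p.1 * V p.2)%:E).
  apply/(integrable12ltyP _ _ mUV) => /=.
  have [_ Uoo] := integrableP _ _ _ iU; have [_ Voo] := integrableP _ _ _ iV.
  under eq_integral => x _.
    under eq_integral => y _ do rewrite normrM EFinM.
    rewrite ge0_integralZl//; last by apply/measurable_EFinP; exact: measurableT_comp.
    over.
  rewrite ge0_integralZr//; last 2 first.
  - by apply/measurable_EFinP; exact: measurableT_comp.
  - exact: integral_ge0.
  by apply: lte_mul_pinfty => //; [exact: integral_ge0|rewrite ge0_fin_numE// integral_ge0].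
rewrite -(integral12_prod_meas1 iUV) /fubini_F /=.
under eq_integral => x _.
  under eq_integral => y _ do rewrite EFinM.
  rewrite integralZl// Vv; over.
by rewrite integralZr// Uu.
Qed.

Lemma integrable_bounded_co (f : R -> R) (a b : R) :
  continuous f -> (forall x, `|f x| <= 1)%R ->
  mu.-integrable `[a, b[ (EFin \o f).
Proof.
move=> cf f1.
have abE : mu `[a, b[%classic < +oo.
  by rewrite lebesgue_measure_itv/=; case: ifP => _; rewrite -?EFinB ltry.
apply: measurable_bounded_integrable => //.
- by apply: measurable_funTS; exact: continuous_measurable_fun.
- by exists 1%R; split => // y y1 x _ /=; rewrite (le_trans (f1 x))// ltW.
Qed.

(** The moment of order 0 gives the integrability of [weight], and 2^k times [weight] dominates the
    rest. *)
Lemma integrable_radial k : mu.-integrable `[0%R, 2%R[ (fun x => (x ^+ k * weight x)%:E).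
Proof.
have i0 : mu.-integrable `[0%R, 2%R[ (fun x => (weight x)%:E).
  apply/integrableP; split.
    by apply/measurable_EFinP; apply: measurable_funTS; exact: measurable_weight.
  under eq_integral do rewrite gee0_abs ?lee_fin ?weight_ge0//.
  have := radial_moment R 0; rewrite /=.
  under eq_integral do rewrite expr0 mul1r.
  by move=> ->; rewrite ltry.
apply: (le_integrable _ _ _ (integrableZl _ (2 ^+ k)%R i0)) => //.
  apply/measurable_EFinP; apply: measurable_funTS; apply: measurable_funM.
    exact: measurable_funX.
  exact: measurable_weight.
move=> x /=; rewrite in_itv/= => /andP[x0 x2].
rewrite lee_fin !normrM ler_wpM2r// !normrX lerXn2r ?nnegrE//.
by rewrite ger0_norm// ger0_norm// ltW.
Qed.

End PolarIntegrals.

(** * The two densities and their moments *)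

Section SpectralMeasures.
Variable R : realType.
Local Notation mu := (@lebesgue_measure R).

(* [dr_dtheta] and [arc_length] are bare set functions, to which
   [integral_mkcondr] does not apply. *)
Lemma integral_setI_set_function d (T : measurableType d) (m : set T -> \bar R)
    (D P : set T) (f : T -> R) :
  (\int[m]_(x in D `&` P) (f x)%:E = \int[m]_(x in D) ((f \_ P) x)%:E)%E.
Proof.
rewrite [in RHS](_ : (fun x => _) = (EFin \o f) \_ P); last by rewrite restrict_EFin.
by rewrite /integral patch_setI.
Qed.

Lemma measurable_cos : measurable_fun setT (@cos R).
Proof. by apply: continuous_measurable_fun; exact: continuous_cos. Qed.

Lemma measurable_sin : measurable_fun setT (@sin R).
Proof. by apply: continuous_measurable_fun; exact: continuous_sin. Qed.

Lemma measurable_polar : measurable_fun setT (@polar R).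
Proof.
have m1 := @measurable_fst _ _ (measurableTypeR R) (measurableTypeR R).
have m2 := @measurable_snd _ _ (measurableTypeR R) (measurableTypeR R).
apply: measurable_fun_pair; apply: measurable_funM => //.
  exact: (measurableT_comp measurable_cos m2).
exact: (measurableT_comp measurable_sin m2).
Qed.

Lemma measurable_normc : measurable_fun setT (fun p : plane R => normc (toC p)).
Proof.
apply: measurable_sqrt_comp; apply: measurable_funD; apply: measurable_funX.
  exact: measurable_fst.
exact: measurable_snd.
Qed.

Lemma normc_polar (r t : R) : normc (toC (polar (r, t))) = `|r|.
Proof.
rewrite /= !exprMn -mulrDr cos2Dsin2 mulr1; exact: sqrtr_sqr.
Qed.

Lemma measurable_disk2 : measurable (@disk2 R).
Proof.
have -> : @disk2 R = (fun p => normc (toC p)) @^-1` `]-oo, 2]%classic.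
  by apply/seteqP; split => p; rewrite /disk2/= in_itv.
by rewrite -[X in measurable X]setTI; apply: measurable_normc => //; exact: measurable_itv.
Qed.

Lemma measurable_circle1 : measurable (@circle1 R).
Proof.
have -> : @circle1 R = (fun p => normc (toC p)) @^-1` [set 1] by [].
by rewrite -[X in measurable X]setTI; apply: measurable_normc => //; exact: measurable_set1.
Qed.

Definition disk_density : plane R -> R :=
  (fun p => (pi ^+ 2 * Num.sqrt (4 - normc (toC p) ^+ 2))^-1) \_ (@disk2 R).

Definition circle_density : plane R -> R := (fun=> (2 * pi)^-1) \_ (@circle1 R).

Lemma disk_density_ge0 p : 0 <= disk_density p.
Proof.
rewrite /disk_density patchE; case: ifP => // _.
by rewrite invr_ge0 mulr_ge0 ?sqr_ge0 ?sqrtr_ge0.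
Qed.

Lemma circle_density_ge0 p : 0 <= circle_density p.
Proof.
by rewrite /circle_density patchE; case: ifP => // _; rewrite invr_ge0 mulr_ge0// pi_ge0.
Qed.

Lemma measurable_disk_density : measurable_fun setT disk_density.
Proof.
apply/(measurable_restrict _ measurable_disk2 measurableT); rewrite setTI.
apply: measurable_funTS; apply: measurable_inv_ge0.
  apply: measurable_funM => //; apply: measurable_sqrt_comp.
  by apply: measurable_funB => //; apply: measurable_funX; exact: measurable_normc.
by move=> p; rewrite mulr_ge0 ?sqr_ge0 ?sqrtr_ge0.
Qed.

Lemma measurable_circle_density : measurable_fun setT circle_density.
Proof.
by apply/(measurable_restrict _ measurable_circle1 measurableT); rewrite setTI.
Qed.

Definition polar_domain : set (plane R) := [set` `[0, +oo[%R] `*` [set` `[0, 2 * pi[%R].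

Lemma measurable_polar_domain : measurable polar_domain.
Proof. by apply: measurableX; exact: measurable_itv. Qed.

Lemma disk_density_polar (r t : R) : 0 <= r ->
  disk_density (polar (r, t)) = if r < 2 then (pi ^+ 2)^-1 * weight r else 0.
Proof.
move=> r0; rewrite /disk_density patchE.
have -> : (polar (r, t) \in @disk2 R) = (r <= 2).
  by apply/idP/idP => [/set_mem|r2]; [|apply/mem_set];
    rewrite /disk2 /mkset normc_polar ger0_norm.
rewrite normc_polar ger0_norm// le_eqVlt invfM.
(* On the boundary circle the density is the inverse of 0, that is 0, so the closed disk can be
   traded for r < 2. *)
have [->|_] := eqVneq r 2; last by [].
by rewrite ltxx (_ : 4 - 2 ^+ 2 = 0) ?sqrtr0 ?invr0 ?mulr0//; ring.
Qed.

Lemma circle_density_polar (t : R) : circle_density (polar (1, t)) = (2 * pi)^-1.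
Proof.
rewrite /circle_density patchE mem_set//.
by rewrite /circle1 /mkset normc_polar normr1.
Qed.

Lemma integrable_restrict_co (f : R -> R) (a b : R) :
  mu.-integrable `[a, b[ (EFin \o f) ->
  mu.-integrable setT (EFin \o (f \_ `[a, b[)).
Proof.
move=> fab; rewrite -restrict_EFin.
have /integrable_mkcond mkcond :
  measurable (`[a, b[%classic : set (measurableTypeR R)) by exact: measurable_itv.
exact: (mkcond R mu (EFin \o f)).1.
Qed.

(** Left unevaluated for odd [k]: when m and n differ, the angular factor vanishes whatever this
    number is. *)
Definition radial (k : nat) : R := fine (\int[mu]_(x in `[0%R, 2%R[) (x ^+ k * weight x)%:E)%E.

Lemma integral_polar (k : nat) (f : R -> R) (a : R) :
  continuous f -> (forall x, `|f x| <= 1) ->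
  (\int[mu]_(t in `[0%R, (2 * pi)%R[) (f t)%:E = a%:E)%E ->
  (\int[mu \x mu]_(x in polar_domain)
     (x.1 ^+ k * f x.2 * disk_density (polar x))%:E =
   ((pi ^+ 2)^-1 * radial k * a)%:E)%E.
Proof.
move=> cf f1 fa.
pose u (r : R) := (pi ^+ 2)^-1 * (r ^+ k * weight r).
have iu : mu.-integrable `[0%R, 2%R[ (EFin \o u).
  exact: (integrableZl _ ((pi ^+ 2)^-1) (integrable_radial R k)).
have fu : (\int[mu]_(x in `[0%R, 2%R[) (u x)%:E = ((pi ^+ 2)^-1 * radial k)%:E)%E.
  rewrite EFinM fineK; last by apply: integrable_fin_num => //; exact: integrable_radial.
  under eq_integral do rewrite EFinM.
  by rewrite integralZl//; exact: integrable_radial.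
(* Extended by 0 to the plane, the integrand is a function of r supported in [0, 2[ times a function
   of theta supported in [0, 2 pi[, and Fubini applies. *)
rewrite integral_mkcond.
rewrite -(@integral_product_fun _ (u \_ `[0%R, 2%R[) (f \_ `[0%R, (2 * pi)%R[)); last 4 first.
- exact: integrable_restrict_co.
- by apply: integrable_restrict_co; exact: integrable_bounded_co.
- by rewrite -fu [RHS]integral_mkcond; under [RHS]eq_integral do rewrite restrict_EFin.
- by rewrite -fa [RHS]integral_mkcond; under [RHS]eq_integral do rewrite restrict_EFin.
apply: eq_integral => -[r t] _; rewrite !patchE /=.
have -> : ((r, t) \in polar_domain) = (0 <= r) && (t \in `[0%R, (2 * pi)%R[%classic).
  apply/idP/andP => [/set_mem[/= r0 tt]|[r0 /set_mem tt]].
    by split; [move: r0; rewrite in_itv/= andbT|apply/mem_set].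
  by apply/mem_set; split => //=; rewrite in_itv/= andbT.
have -> : (r \in `[0%R, 2%R[%classic) = (0 <= r) && (r < 2).
  by apply/idP/idP => [/set_mem|r2]; [|apply/mem_set]; rewrite /= in_itv.
case: ifPn => [/andP[r0 ->]|]; last first.
  by rewrite negb_and => /orP[/negbTE->|/negbTE->]; rewrite ?mul0r ?mulr0.
rewrite disk_density_polar// r0 /=; case: ifP => _; rewrite ?mulr0 ?mul0r//.
by congr EFin; rewrite /u; ring.
Qed.

Lemma continuous_angular (m n : nat) :
  continuous (fun t : R => cos ((m%:R - n%:R) * t)) /\
  continuous (fun t : R => sin ((m%:R - n%:R) * t)).
Proof.
split=> t; first exact: is_derive_continuous (is_derive_scale (is_derive_cos _)).
exact: is_derive_continuous (is_derive_scale (is_derive_sin _)).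
Qed.

Lemma radial_even m : (pi ^+ 2)^-1 * radial m.*2 * (2 * pi) = 'C(m.*2, m)%:R.
Proof.
rewrite /radial radial_moment [fine _]/=.
have : pi != 0 :> R by rewrite gt_eqF// pi_gt0.
by move: (pi : R) => p p0; field.
Qed.

Lemma normc_square (M : R) p : normc (toC p) <= M -> square M p.
Proof.
rewrite /toC /=; case: p => x y /=; set s := Num.sqrt _ => sM.
have s2 : s ^+ 2 = x ^+ 2 + y ^+ 2 by rewrite sqr_sqrtr// addr_ge0 ?sqr_ge0.
have s0 : 0 <= s by rewrite sqrtr_ge0.
split => /=; apply: le_trans sM; rewrite -ler_sqr ?nnegrE// real_normK ?num_real// s2.
  by rewrite lerDl sqr_ge0.
by rewrite lerDr sqr_ge0.
Qed.

Lemma square_compactly_supported (nu : probability (plane R) R) (M : R) :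
  nu (~` square M) = 0%E -> compactly_supported nu.
Proof.
move=> nuM; exists (`[- M, M]%classic `*` `[- M, M]%classic); split.
  by apply: compact_setX; exact: segment_compact.
rewrite -nuM; congr (nu (~` _)); apply/seteqP; split => -[x y];
  by rewrite /square /= !in_itv/= !ler_norml.
Qed.

Lemma measurable_monomial m n :
  measurable_fun setT (fun p : plane R => complex.Re (toC p ^+ m * (toC p)^* ^+ n)) /\
  measurable_fun setT (fun p : plane R => complex.Im (toC p ^+ m * (toC p)^* ^+ n)).
(* Only the measurability half of admissibility is kept, so the size 0 of the square is
   arbitrary. *)
Proof. by have [[? _] [? _]]  := @cadmissible_monomial R 0 m n. Qed.

Lemma disk_spectral_measure : exists nu : probability (plane R) R,
  [/\ compactly_supported nu,
   forall m n, cintegral nu (fun p => toC p ^+ m * (toC p)^* ^+ n) =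
     if m == n then 'C(m.*2, m)%:R else 0 &
   forall E : set (plane R), nu E =
     (\int[@dr_dtheta R]_(x in E `&` @disk2 R)
        ((pi ^+ 2 * Num.sqrt (4 - normc (toC x) ^+ 2))^-1)%:E)%E].
Proof.
have cosn1 (m n : nat) (t : R) : `|cos ((m%:R - n%:R) * t)| <= 1.
  by rewrite ler_norml cos_geN1 cos_le1.
have sinn1 (m n : nat) (t : R) : `|sin ((m%:R - n%:R) * t)| <= 1.
  by rewrite ler_norml sin_geN1 sin_le1.
have [|nu [nuE nuI]] := @pushed_density _ _ _ _ R (mu \x mu)%E _ _ _ measurable_polar_domain
    measurable_polar measurable_disk_density disk_density_ge0.
  (* The total mass is the moment of order (0, 0). *)
  have [c00 _] := continuous_angular 0 0.
  have := integral_polar 0 c00 (cosn1 0%N 0%N) (integral_cos R 0 0).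
  rewrite (radial_even 0) => <-; apply: eq_integral => x _.
  by rewrite expr0 subrr mul0r cos0 !mul1r.
exists nu; split.
- have mS : measurable (~` square 2 : set (plane R)).
    by apply: measurableC; exact: measurable_square.
  apply: (@square_compactly_supported _ 2).
  rewrite -[X in nu X]setIT -(integral_indic nu measurableT mS) nuI; last exact: measurable_indic.
  (* The density vanishes off the disk, which lies in the square, so its product with the indicator
     of the complement is 0. *)
  rewrite integral0_eq// => x _; congr EFin.
  rewrite indicE /disk_density patchE.
  have [nsq|_] := boolP (_ \in ~` _); last by rewrite mul0r.
  case: ifPn => [/set_mem xd|_]; last by rewrite mulr0.
  by case: (set_mem nsq); apply: normc_square; rewrite ?xd.
- move=> m n; rewrite /cintegral /Rintegral.
  have [mRe mIm] := measurable_monomial m n; rewrite !nuI//.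
  have [ccos csin] := continuous_angular m n.
  under eq_integral => x _ do rewrite {1}[x]surjective_pairing monomial_polar.
  under [in X in (_ +i* X)%C]eq_integral => x _ do rewrite {1}[x]surjective_pairing monomial_polar.
  rewrite /= (integral_polar _ ccos (cosn1 m n) (integral_cos R m n)).
  rewrite (integral_polar _ csin (sinn1 m n) (integral_sin R m n)) /= mulr0.
  have [<-|_] := eqVneq m n; last by rewrite mulr0.
  by rewrite addnn radial_even -[RHS](rmorph_nat (real_complex R)).
- by move=> E; rewrite integral_setI_set_function; exact: nuE.
Qed.

Lemma circle_spectral_measure : exists nu : probability (plane R) R,
  [/\ compactly_supported nu,
   forall m n, cintegral nu (fun p => toC p ^+ m * (toC p)^* ^+ n) = (m == n)%:R &
   forall E : set (plane R), nu E =
     (\int[@arc_length R]_(y in E `&` @circle1 R) ((2 * pi)^-1)%:E)%E].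
Proof.
have pi0 : 2 * pi != 0 :> R by rewrite mulf_neq0// gt_eqF// pi_gt0.
have cosn1 (m n : nat) (t : R) : `|cos ((m%:R - n%:R) * t)| <= 1.
  by rewrite ler_norml cos_geN1 cos_le1.
have sinn1 (m n : nat) (t : R) : `|sin ((m%:R - n%:R) * t)| <= 1.
  by rewrite ler_norml sin_geN1 sin_le1.
have mcirc : measurable_fun setT (fun t : measurableTypeR R => polar (1, t)).
  by apply: (measurableT_comp measurable_polar); exact: measurable_fun_pair.
have mD : measurable (`[0, 2 * pi[%classic : set (measurableTypeR R)).
  exact: measurable_itv.
have [|nu [nuE nuI]] := @pushed_density _ _ _ _ R mu _ _ _ mD mcirc measurable_circle_density
    circle_density_ge0.
  under eq_integral do rewrite circle_density_polar -[_^-1]mul1r EFinM.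
  rewrite ge0_integralZr//; last by rewrite lee_fin invr_ge0 mulr_ge0// pi_ge0.
  have -> : (\int[mu]_(x in `[0%R, (2 * pi)%R[) 1%:E = (2 * pi)%:E)%E.
    rewrite -[RHS](integral_cos R 0 0); apply: eq_integral => t _.
    by rewrite subrr mul0r cos0.
  by rewrite -EFinM mulfV.
exists nu; split.
- have mS : measurable (~` square 1 : set (plane R)).
    by apply: measurableC; exact: measurable_square.
  apply: (@square_compactly_supported _ 1).
  rewrite -[X in nu X]setIT -(integral_indic nu measurableT mS) nuI; last exact: measurable_indic.
  rewrite integral0_eq// => x _; congr EFin.
  rewrite indicE /circle_density patchE.
  have [nsq|_] := boolP (_ \in ~` _); last by rewrite mul0r.
  case: ifPn => [/set_mem xd|_]; last by rewrite mulr0.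
  by case: (set_mem nsq); apply: normc_square; rewrite ?xd.
- move=> m n; rewrite /cintegral /Rintegral.
  have [mRe mIm] := measurable_monomial m n; rewrite !nuI//.
  have [ccos csin] := continuous_angular m n.
  under eq_integral do rewrite circle_density_polar monomial_polar /= expr1n mul1r EFinM.
  under [in X in (_ +i* X)%C]eq_integral do
    rewrite circle_density_polar monomial_polar /= expr1n mul1r EFinM.
  rewrite !integralZr//; try exact: integrable_bounded_co.
  rewrite integral_cos integral_sin mul0e /=.
  have [_|_] := eqVneq m n; last by rewrite mul0r.
  by rewrite mulfV// -[RHS](rmorph_nat (real_complex R)).
- by move=> E; rewrite integral_setI_set_function; exact: nuE.
Qed.

(** A competitor [nu'] has its moments expressed with some adjoint [B]; on the iterates of [delta0]
    it can be replaced by the explicit one, so [nu'] and [nu] have equal moments. *)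
Lemma spectral_measure_translations s (nu : probability (plane R) R) :
  compactly_supported nu ->
  (forall m n, inner (iter m (translations s)
      (iter n (translations (map -%R s)) (@delta0 R))) (@delta0 R) =
    cintegral nu (fun p => toC p ^+ m * (toC p)^* ^+ n)) ->
  is_spectral_measure (translations s) nu.
Proof.
move=> cnu mom; split.
  by split => //; exists (translations (map -%R s)) => //; exact: is_adjoint_translations.
move=> nu' [cnu' [B adjB momB]] E mE.
apply: moments_unique mE => // m n; rewrite -momB -mom.
by rewrite (adjoint_iter n adjB (is_adjoint_translations R s))//; exact: l2_delta.
Qed.

End SpectralMeasures.

Theorem theorem6p2 (R : realType) :
  (exists nu1 : probability (plane R) R,
     is_spectral_measure (adjacency (graphH (@chi_rho1 R))) nu1 /\
     forall E : set (plane R), measurable E ->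
       nu1 E = (\int[@dr_dtheta R]_(x in E `&` @disk2 R)
                  ((pi ^+ 2 * Num.sqrt (4 - normc (toC x) ^+ 2))^-1)%:E)%E) /\
  (exists nu2 : probability (plane R) R,
     is_spectral_measure (adjacency (graphH (@chi_rho2 R))) nu2 /\
     forall E : set (plane R), measurable E ->
       nu2 E = (\int[@arc_length R]_(y in E `&` @circle1 R)
                  ((2 * pi)^-1)%:E)%E).
Proof.
split.
  have [nu [cnu mom nuE]] := disk_spectral_measure R; exists nu; split; last by [].
  rewrite graphH_rho1 adjacency_edges1; apply: spectral_measure_translations => // m n.
  by rewrite mom moments_edges1.
have [nu [cnu mom nuE]] := circle_spectral_measure R; exists nu; split; last by [].
rewrite graphH_rho2 adjacency_edges2; apply: spectral_measure_translations => // m n.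
by rewrite mom moments_edges2.
Qed.
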